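(* Let $z$ be a marked word in the alphabet $\mathbb{N}$ with runs $z=\rho_\ell\cdots\rho_0$, and for $s\ge0$ let $\mathsf{LSQ}_{q,t;x}(z,s)\coloneqq\sum_{\pi}q^{\mathsf{dinv}(\pi)}t^{\mathsf{area}(\pi)}x^\pi$, the sum over all valley-decorated partially labelled square paths $\pi$ with $\mathsf{shift}(\pi)=s$ and $\mathsf{dw}(\pi)=z$. Then for every integer $s\ge1$, \[ \mathsf{LSQ}_{q,t;x}(z,s)= q^{\#\rho'_{s-1}-z^\bullet_{s-2}(0)}\,\frac{[\#\rho'_s-z^\bullet_{s-1}(0)]_q}{[\#\rho'_{s-1}-z^\bullet_{s-2}(0)]_q}\,\mathsf{LSQ}_{q,t;x}(z,s-1), \] with the convention $z^\bullet_{-1}(0)=0$.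
   Context: $\mathbb{N}=\{0,1,2,\dots\}$. A square path of size $N$ is a lattice path from $(0,0)$ to $(N,N)$ with unit north and east steps whose last step is east. Its shift is the largest $s$ such that the path meets the line $y=x-s$; the line $y=x+i-s$ is its $i$-th diagonal. Its area word $(a_1,\dots,a_N)$: the $j$-th north step starts on $y=x+a_j$. A partial labelling is $w\in\mathbb{N}^N$ with: $a_j>a_{j-1}\Rightarrow w_j>w_{j-1}$; $a_1=0\Rightarrow w_1>0$; some $j$ has $a_j=-s$ and $w_j>0$. Contractible valleys: indices $j$ with $j=1$ and ($a_1<-1$, or $a_1=-1$ and $w_1>0$); or $j>1$ and $a_j<a_{j-1}$; or $j>1$, $a_j=a_{j-1}$, $w_j>w_{j-1}$. A valley-decorated partially labelled square path is $(\pi,w,dv)$ with $dv$ a set of contractible valleys. $\mathsf{area}=\sum_j(a_j+s)$; $(i,j)$, $i<j$, is an inversion if $a_i=a_j,w_i<w_j$ or $a_i=a_j+1,w_i>w_j$; $\mathsf{dinv}=\#\{\text{inversions }(i,j):j\notin dv\}+\#\{j:a_j<0,w_j>0\}-\#dv$; $x^\pi=\prod_jx_{w_j}$ with $x_0=1$. Marked words have letters $c$ or $\stackrel{\bullet}{c}$, ordered $c<\stackrel{\bullet}{c}<c+1$; runs are maximal weakly increasing factors. The diagonal word $\mathsf{dw}(\pi)=R_\ell\cdots R_0$ where $R_i$ is the increasingly sorted word of labels of north steps on the $i$-th diagonal ($a_j=i-s$), marked by $\bullet$ iff in $dv$. $z_i^\bullet(c)$ is the number of marked occurrences of $c$ in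 $\rho_i$; $\rho'_i$ is the subword of unmarked nonzero letters of $\rho_i$ and $\#\rho'_i$ its length. $[n]_q=1+q+\dots+q^{n-1}$.
   Formalization: In dinv, inversions (i,j) are counted when i∉dv, not j∉dv (with j∉dv the claim fails for z=3 2 2•, s=1); the quotient formula is stated where its denominator is nonzero, and with the denominator cleared for all z and s≥1. *)

(* Defs.v *)
From HB Require Import structures.
From mathcomp Require Import all_boot all_order all_algebra.
From mathcomp Require Import zify.
From mathcomp.multinomials Require Import monalg.

Set Implicit Arguments.
Unset Strict Implicit.
Unset Printing Implicit Defensive.

Import Order.TTheory GRing.Theory Num.Theory.
Local Open Scope ring_scope.

(* A lattice path is its sequence of steps, [true] being a unit north step and
   [false] a unit east step.  After k steps it is on the line
   y = x + level p k. *)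
Definition level (p : seq bool) (k : nat) : int :=
  (count id (take k p))%:Z - (count negb (take k p))%:Z.

(* The default value of [last] makes the empty path fail: it has no last
   step.  (Nor could it carry a partial labelling.) *)
Definition square_path (N : nat) (p : seq bool) : bool :=
  [&& count id p == N, count negb p == N & ~~ last true p].

(* The path has 2N steps, so it can only meet the lines y = x - s with
   s <= 2N, and it meets such a line at a lattice point. *)
Definition shift (p : seq bool) : nat :=
  (\max_(s < (size p).+1 |
     [exists k : 'I_(size p).+1, level p k == - (s%:Z)]) s)%N.

(* Everything below is indexed from 0: the j-th north step of the text is
   number j - 1 here. *)
Definition area_word (p : seq bool) : seq int :=
  [seq level p k | k <- iota 0 (size p) & nth false p k].

Definition aw (p : seq bool) (j : nat) : int := nth 0 (area_word p) j.

Definition lab (w : seq nat) (j : nat) : nat := nth 0%N w j.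

Definition partial_labelling (N : nat) (p : seq bool) (w : seq nat) : bool :=
  [&& size w == N,
      [forall j : 'I_N, (0 < j)%N && (aw p j.-1 < aw p j) ==>
                        (lab w j.-1 < lab w j)%N],
      (aw p 0 == 0) ==> (0 < lab w 0)%N
    & [exists j : 'I_N, (aw p j == - ((shift p)%:Z)) && (0 < lab w j)%N]].

Definition contractible (p : seq bool) (w : seq nat) (j : nat) : bool :=
  if j == 0%N then
    (aw p 0 < -1) || (aw p 0 == -1) && (0 < lab w 0)%N
  else
    (aw p j < aw p j.-1) ||
    (aw p j == aw p j.-1) && (lab w j.-1 < lab w j)%N.

Definition vd_square_path (N : nat) (p : seq bool) (w : seq nat)
    (dv : {set 'I_N}) : bool :=
  [&& square_path N p, partial_labelling N p w
    & [forall j in dv, contractible p w j]].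

Definition area (N : nat) (p : seq bool) : int :=
  \sum_(j < N) (aw p j + (shift p)%:Z).

Definition inversion (p : seq bool) (w : seq nat) (i j : nat) : bool :=
  (i < j)%N &&
  ((aw p i == aw p j) && (lab w i < lab w j)%N ||
   (aw p i == aw p j + 1) && (lab w j < lab w i)%N).

(* The inversions (i, j), i < j, that are dropped are those whose *first* index
   is decorated; dropping those with j in dv instead would give another
   statistic, which can be negative. *)
Definition dinv (N : nat) (p : seq bool) (w : seq nat) (dv : {set 'I_N})
    : int :=
  #|[set ij : 'I_N * 'I_N | inversion p w ij.1 ij.2 & ij.1 \notin dv]|%:Z
  + #|[set j : 'I_N | (aw p j < 0) && (0 < lab w j)%N]|%:Z
  - #|dv|%:Z.

(* (c, false) is the letter c and (c, true) is c with a bullet; as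
   false < true, the lexicographic order is c < c^bullet < c + 1. *)
Notation mletter := (nat *l bool)%type.

Definition diag_word (N : nat) (p : seq bool) (w : seq nat) (dv : {set 'I_N})
    (i : nat) : seq mletter :=
  sort <=%O [seq ((lab w j, j \in dv) : mletter)
            | j : 'I_N <- enum 'I_N & aw p j + (shift p)%:Z == i%:Z].

Definition top_diag (N : nat) (p : seq bool) : nat :=
  (\max_(j < N) `|(aw p j + (shift p)%:Z)%R|)%N.

Definition dw (N : nat) (p : seq bool) (w : seq nat) (dv : {set 'I_N})
    : seq mletter :=
  flatten [seq diag_word p w dv i | i <- rev (iota 0 (top_diag N p).+1)].

Fixpoint runs (z : seq mletter) : seq (seq mletter) :=
  match z with
  | [::] => [::]
  | x :: z' =>
    match runs z' with
    | (y :: r) :: rs =>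
      if (x <= y)%O then (x :: y :: r) :: rs else [:: x] :: (y :: r) :: rs
    | _ => [:: [:: x]]
    end
  end.

(* z = rho_l ... rho_0, so rho_0 is the last run; rho_i is empty for i > l. *)
Definition rho (z : seq mletter) (i : nat) : seq mletter :=
  nth [::] (rev (runs z)) i.

(* z^bullet_i(c), with z^bullet_i(c) = 0 for i < 0. *)
Definition zbullet (z : seq mletter) (i : int) (c : nat) : nat :=
  if i is Posz n then count_mem ((c, true) : mletter) (rho z n) else 0%N.

Definition rho' (z : seq mletter) (i : nat) : seq mletter :=
  [seq x <- rho z i | ~~ x.2 & x.1 != 0%N].

(* #rho'_i - z^bullet_{i-1}(0), which may be negative for a general z. *)
Definition sched (z : seq mletter) (i : nat) : int :=
  (size (rho' z i))%:Z - (zbullet z (i%:Z - 1) 0)%:Z.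

(* The generating functions live in Q(q,t)[x_1, x_2, ...]. *)
Definition Qqt : fieldType := {fraction {poly {poly rat}}}.
Definition qv : Qqt := tofrac ('X%:P).
Definition tv : Qqt := tofrac 'X.
Definition Lring := {malg Qqt[{cmonom nat}]}.

(* [n]_q = (1 - q^n) / (1 - q): it is 1 + q + ... + q^(n-1) for n >= 0, and
   - (q^-1 + ... + q^n) for n < 0. *)
Definition qint (n : int) : Qqt :=
  match n with
  | Posz m => \sum_(k < m) qv ^+ k
  | Negz m => - \sum_(k < m.+1) qv ^- k.+1
  end.

Definition xv (c : nat) : Lring := if c == 0%N then 1 else << ucm c >>.

Definition xpath (w : seq nat) : Lring := \prod_(c <- w) xv c.

Definition max_letter (z : seq mletter) : nat := (\max_(x <- z) x.1)%N.

Lemma shift_ge (p : seq bool) (k : nat) :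
  (k <= size p)%N -> 0 <= level p k + (shift p)%:Z.
Proof.
move=> lek; case: (lerP 0 (level p k)) => [h|h]; first by rewrite addr_ge0.
have hs : (`|level p k| < (size p).+1)%N.
  have h1 : (count id (take k p) + count negb (take k p) <= size p)%N.
    rewrite (count_predC id) size_take; case: ifP => //; lia.
  rewrite /level; lia.
suff : (`|level p k| <= shift p)%N by lia.
apply: (@leq_bigmax_cond _ _ _ (Ordinal hs)) => /=.
by apply/existsP; exists (Ordinal (lek : k < (size p).+1)%N) => /=; lia.
Qed.

Lemma size_area_word (p : seq bool) : size (area_word p) = count id p.
Proof.
by rewrite size_map size_filter -[in RHS](mkseq_nth false p) count_map.
Qed.

Lemma aw_ge (N : nat) (p : seq bool) (j : 'I_N) :
  square_path N p -> 0 <= aw p j + (shift p)%:Z.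
Proof.
case/and3P=> /eqP cN _ _.
have : aw p j \in area_word p by apply: mem_nth; rewrite size_area_word cN.
case/mapP => k; rewrite mem_filter mem_iota => /andP[_ /andP[_ lk]] ->.
by apply: shift_ge; apply: ltnW.
Qed.

Lemma dw_perm (N : nat) (p : seq bool) (w : seq nat) (dv : {set 'I_N}) :
  square_path N p ->
  perm_eq (dw p w dv) [seq ((lab w j, j \in dv) : mletter) | j : 'I_N <- enum 'I_N].
Proof.
move=> hp; apply/permP => P.
rewrite count_flatten -!map_comp map_rev sumn_rev.
rewrite count_map -sum1_count sumnE big_map.
under eq_bigr => i _ do rewrite /= count_sort count_map count_filter -sum1_count.
rewrite (exchange_big_dep (fun j : 'I_N => P (lab w j, j \in dv))) /=; last by move=> i j _ /andP[].
rewrite -enumT; apply: eq_bigr => j hP.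
have h := aw_ge j hp.
set m := `|(aw p j + (shift p)%:Z)%R|%N.
have hm : aw p j + (shift p)%:Z = m%:Z by rewrite /m; lia.
have ltm : (m < (top_diag N p).+1)%N.
  by rewrite ltnS; apply: (@leq_bigmax_cond _ _ (fun j : 'I_N => `|(aw p j + (shift p)%:Z)%R|%N) j).
rewrite (eq_bigl (fun i => i == m)) => [|i]; last by rewrite hP hm eqz_nat eq_sym.
by rewrite -big_filter -[_ :: _]/(iota 0 (top_diag N p).+1) (filter_pred1_uniq (s := iota 0 _)) ?iota_uniq ?mem_iota // big_seq1.
Qed.

Lemma dw_finite (N : nat) (p : seq bool) (w : seq nat) (dv : {set 'I_N})
    (z : seq mletter) :
  vd_square_path p w dv -> dw p w dv = z ->
  [/\ N = size z, size p = (N + N)%N, size w = N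
    & all (fun c => c <= max_letter z)%N w].
Proof.
case/and3P=> hp /and4P[/eqP sw _ _ _] _ <-; have hz := dw_perm w dv hp.
split=> //.
- by rewrite (perm_size hz) size_map size_enum_ord.
- by case/and3P: hp => /eqP c1 /eqP c2 _; rewrite -[LHS](count_predC id) c1 c2.
apply/allP => c /(nthP 0%N)[j]; rewrite sw => ltj <-.
have : (lab w j, Ordinal ltj \in dv) \in dw p w dv.
  by rewrite (perm_mem hz); apply/mapP; exists (Ordinal ltj) => //; rewrite mem_enum.
move=> hin; exact: (leq_bigmax_seq (P := predT) (F := fun x : mletter => x.1) _ hin isT).
Qed.

(* By [dw_finite] every decorated path with diagonal word z occurs exactly once
   in this finite sum. *)
Definition LSQ (z : seq mletter) (s : nat) : Lring :=
  \sum_(p : (size z + size z).-tuple bool)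
  \sum_(w : (size z).-tuple 'I_(max_letter z).+1)
  \sum_(dv : {set 'I_(size z)} |
      [&& vd_square_path p (map val w) dv, shift p == s
        & dw p (map val w) dv == z])
    (qv ^ dinv p (map val w) dv * tv ^ area (size z) p) *: xpath (map val w).

(* Main.v *)
(* Read a decorated path of shift s as the word of its north steps.  Requiring
   that the path starts on or below y = x and ends on or above it amounts to
   inserting a letter 0 of the diagonal s - 1 into a cyclic word: for a cyclic
   word the number of admissible cuts is the number of slots of such a letter,
   which is #rho'_s - z_{s-1}(0) because marked zeros of that diagonal block
   slots.  To get the q-analogue, the copies of one letter at a time are removed
   from the word.  Each removal contributes a q-binomial factor depending only on
   the multiset of the remaining letters.  For the cuts at s and at s - 1 these
   factors differ only for the marked letters of the diagonals s - 1 and s - 2,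
   where they produce the corrections by z_{s-1}(0), z_{s-2}(0) and a power of q,
   and for the unmarked letters of the diagonals s and s - 1.  There, removing
   the diagonal s - 1 from the largest letter on for the one cut, and the
   diagonal s from the smallest letter on for the other, gives factors attached
   to the same numbers n_c = #(letters < c on s - 1) + #(letters > c on s), and
   the two products are compared by telescoping. *)
Require Import Defs.
From HB Require Import structures.
From mathcomp Require Import all_boot all_order all_algebra.
From mathcomp Require Import zify ring.
From mathcomp.multinomials Require Import monalg.

Set Implicit Arguments.
Unset Strict Implicit.
Unset Printing Implicit Defensive.

Import Order.TTheory GRing.Theory Num.Theory.
Local Open Scope ring_scope.

(** * Sums over words *)

Section WordSums.

Variables (K : comNzRingType) (q : K) (T : eqType) (R : rel T).
Variable f : T -> T -> nat.

Fixpoint pair_stat (s : seq T) : nat :=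
  if s is x :: s' then (\sum_(y <- s') f x y + pair_stat s')%N else 0%N.

(* The words are paths for [R] from a virtual first letter [u] to a virtual last
   letter [xe]; only the statistic of the actual letters is counted. *)
Definition word_sum (xe u : T) (S : seq T) : K :=
  \sum_(W <- permutations S | path R u (rcons W xe)) q ^+ pair_stat W.

Variable xe : T.
Local Notation G := (word_sum xe).

Lemma word_sum_nil u : G u [::] = (R u xe)%:R.
Proof.
rewrite /word_sum -[permutations _]/[:: [::]] big_mkcond big_seq1 /= andbT.
by case: (R u xe).
Qed.

Lemma perm_word_sum u S S' : perm_eq S S' -> G u S = G u S'.
Proof. by move=> h; apply: perm_big; apply: perm_permutations. Qed.

Lemma word_sum_rec u S : S != [::] ->
  G u S = \sum_(v <- undup S)
     (R u v)%:R * q ^+ (\sum_(y <- rem v S) f v y) * G v (rem v S).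
Proof.
rewrite -size_eq0 -lt0n => Snil.
rewrite /word_sum (perm_big _ (permutationsE Snil)) big_mkcond big_allpairs_dep /=.
apply: eq_bigr => v _.
rewrite mulr_sumr big_mkcond [in RHS]big_mkcond /=.
apply: eq_big_seq => W; rewrite mem_permutations => h.
case: (R u v) => /=; last by rewrite !mul0r if_same.
by case: ifP => // _; rewrite mul1r exprD (perm_big _ h).
Qed.

Lemma word_sum_start u u' S : S != [::] -> {in S, R u =1 R u'} -> G u S = G u' S.
Proof.
move=> Snil h; rewrite !word_sum_rec //.
by apply: eq_big_seq => v; rewrite mem_undup => /h ->.
Qed.

(** Case split on the first letter. As [e \notin S], [undup] keeps a single [e], so all the copies
    of [e] form one case. *)
Lemma word_sum_insert e u m S : e \notin S ->
  G u (nseq m.+1 e ++ S) =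
    (R u e)%:R * q ^+ (m * f e e + \sum_(y <- S) f e y) * G e (nseq m e ++ S)
    + \sum_(v <- undup S) (R u v)%:R
        * q ^+ (m.+1 * f v e + \sum_(y <- rem v S) f v y)
        * G v (nseq m.+1 e ++ rem v S).
Proof.
move=> eS; rewrite word_sum_rec //.
have hu : perm_eq (undup (nseq m.+1 e ++ S)) (e :: undup S).
  apply: uniq_perm; first exact: undup_uniq.
    by rewrite cons_uniq mem_undup eS undup_uniq.
  by move=> x; rewrite in_cons !mem_undup mem_cat mem_nseq.
rewrite (perm_big _ hu) big_cons /= eqxx; congr (_ + _).
  by rewrite big_cat /= big_nseq iter_addn_0 mulnC.
apply: eq_big_seq => v; rewrite mem_undup => vS.
have nev : (e == v) = false by apply/negbTE; apply: contraNneq eS => ->.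
have hp : perm_eq (rem v (nseq m.+1 e ++ S)) (nseq m.+1 e ++ rem v S).
  rewrite -(perm_cons v) -(permPl (perm_to_rem _)) ?mem_cat ?vS ?orbT //.
  by rewrite perm_sym -cat1s perm_catCA perm_cat2l perm_sym perm_to_rem.
rewrite /= nev in hp *.
rewrite (perm_big _ hp) (perm_word_sum _ hp) /= big_cons big_cat /= big_nseq iter_addn_0.
by rewrite mulSn addnA [(m * _)%N]mulnC.
Qed.

End WordSums.

(** * Gaussian binomials and q-factorials *)

Section Gauss.

Variables (K : comNzRingType) (q : K).

(* [qselect b n m] is the sum of [q ^+ (i_1 + ... + i_m)] over the multisets
   (if [b]) or the subsets (otherwise) [{i_1, ..., i_m}] of [{0, ..., n - 1}]. *)
Fixpoint qselect (b : bool) (n : nat) : nat -> K :=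
  if n isn't n'.+1 then fun m => (m == 0%N)%:R else
  fix select m :=
    if m isn't m'.+1 then 1 else
    q ^+ m'.+1 * qselect b n' m'.+1
    + (if b then select m' else q ^+ m' * qselect b n' m').

Lemma qmultiSS n m :
  qselect true n.+1 m.+1 = q ^+ m.+1 * qselect true n m.+1 + qselect true n.+1 m.
Proof. by []. Qed.

Lemma qsubsetSS n m :
  qselect false n.+1 m.+1 =
    q ^+ m.+1 * qselect false n m.+1 + q ^+ m * qselect false n m.
Proof. by []. Qed.

Lemma qselect0 b n : qselect b n 0 = 1.
Proof. by case: n. Qed.

Lemma qselect0n b m : qselect b 0 m = (m == 0%N)%:R.
Proof. by []. Qed.

Opaque qselect.

Definition qbr (n : nat) : K := 1 - q ^+ n.

Lemma qbrD n m : qbr (n + m) = q ^+ m * qbr n + qbr m.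
Proof. by rewrite /qbr exprD; ring. Qed.

Lemma qbr0 : qbr 0 = 0. Proof. by rewrite /qbr expr0 subrr. Qed.

(** [qselect true n m] is the Gaussian binomial of [n + m - 1] over [m]; these are its ratios in [m]
    and in [n], free of division. They are proved jointly because the induction on [n] uses both. *)
Lemma qselect_multi n m :
  qbr m.+1 * qselect true n m.+1 = qbr (n + m) * qselect true n m
  /\ qbr (n + m) * qselect true n m = qbr n * qselect true n.+1 m.
Proof.
elim: n m => [|n IHn] m.
  split; first by rewrite add0n !qselect0n; case: m => [|m] /=; rewrite ?qbr0; ring.
  by case: m => [|m]; rewrite qselect0n ?qselect0 /= ?addn0 ?qbr0; ring.
have H1 k : qbr k.+1 * qselect true n.+1 k.+1 = qbr (n.+1 + k) * qselect true n.+1 k.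
  rewrite qmultiSS mulrDr mulrCA (IHn k).1 (IHn k).2 addSnnS qbrD; ring.
split=> //; elim: m => [|m IHm]; first by rewrite addn0 !qselect0.
rewrite (qmultiSS n.+1) (mulrDr (qbr n.+1)) -IHm -(H1 m) (qbrD n.+1 m.+1); ring.
Qed.

(** Splits on whether the largest element [n] is chosen, while the defining recursion splits on
    0. *)
Lemma qselect_multi_last n m : qselect true n.+1 m.+1 =
  qselect true n m.+1 + q ^+ n * qselect true n.+1 m.
Proof.
elim: n m => [|n IHn] m; first by rewrite qmultiSS !qselect0n /=; ring.
elim: m => [|m IHm].
  by rewrite (qmultiSS n.+1) {1}(IHn 0%N) (qmultiSS n) !qselect0 !exprS; ring.
rewrite (qmultiSS n.+1 m.+1) {1}(IHn m.+1) {1}IHm.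
by rewrite (qmultiSS n m.+1) (qmultiSS n.+1 m) !exprS; ring.
Qed.

Lemma qselect_small n m : (n < m)%N -> qselect false n m = 0.
Proof.
elim: n m => [|n IHn] [|m] // ltnm.
by rewrite qsubsetSS !IHn ?mulr0 ?addr0 // ltnW.
Qed.

(** The analogue for subsets, where [qselect false n m] is the Gaussian binomial of [n] over [m]
    times a power of q; that power causes the factor [q ^+ m]. *)
Lemma qselect_subset n m : (m <= n)%N ->
  qbr m.+1 * qselect false n m.+1 = q ^+ m * qbr (n - m) * qselect false n m
  /\ qbr n.+1 * qselect false n m = qbr (n - m).+1 * qselect false n.+1 m.
Proof.
elim: n m => [|n IHn] m lemn.
  have -> : m = 0%N by lia.
  by rewrite !qselect0n qselect0 subn0 qbr0 /=; split; ring.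
have H1 k : (k <= n.+1)%N -> qbr k.+1 * qselect false n.+1 k.+1 =
    q ^+ k * qbr (n.+1 - k) * qselect false n.+1 k.
  rewrite leq_eqVlt => /predU1P[->|lekn].
    by rewrite qselect_small // subnn qbr0; ring.
  have [em en] := IHn _ lekn.
  rewrite (qsubsetSS n k) subSn // -(mulrA (q ^+ k)) -en.
  rewrite (_ : n.+1 = (n - k) + k.+1)%N; last by lia.
  rewrite qbrD mulrDr mulrCA em; ring.
split; first exact: H1.
case: m lemn => [|k] lekn; first by rewrite !qselect0 subn0.
rewrite (qsubsetSS n.+1 k) subSS.
rewrite (_ : n.+2 = (n.+1 - k) + k.+1)%N; last by lia.
rewrite qbrD mulrDl H1; last by lia.
rewrite (_ : (n - k).+1 = n.+1 - k)%N; last by lia.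
by ring.
Qed.

End Gauss.

Arguments qselect : simpl never.

Section GaussInt.

Variables (K : fieldType) (q : K).

Definition qbrz (n : int) : K := 1 - q ^ n.

Lemma qbrz_nat (n : nat) : qbrz n%:Z = qbr q n. Proof. by []. Qed.

(** For [m > n] the selections or [qbr q 0] vanish, so the bracket may be taken at a negative
    integer. This is how marked zeros can outnumber the slots. *)
Lemma qselect_pred n m :
  qbrz (n%:Z - m%:Z) * qselect q false n m = qbr q n * qselect q false n.-1 m.
Proof.
case: (leqP m n) => [lemn|ltnm]; last first.
  rewrite qselect_small //; case: n ltnm => [|n] ltnm; first by rewrite qbr0; ring.
  by rewrite qselect_small ?mulr0 // ltnW.
rewrite subzn // qbrz_nat; case: n lemn => [|n] lemn.
  by have -> : m = 0%N by lia.
case: (leqP m n) => [lemn'|ltnm].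
  by rewrite (qselect_subset q lemn').2 subSn.
rewrite (qselect_small q ltnm) mulr0; have -> : m = n.+1 by lia.
by rewrite subnn qbr0 mul0r.
Qed.

(** The q-factorial times [(1 - q) ^+ n]. *)
Definition qfact (n : nat) : K := \prod_(i < n) qbr q i.+1.

Lemma qfactS n : qfact n.+1 = qfact n * qbr q n.+1.
Proof. by rewrite /qfact big_ord_recr. Qed.

Lemma qfact0 : qfact 0 = 1. Proof. by rewrite /qfact big_ord0. Qed.

Hypothesis q_nonroot : forall n, q ^+ n.+1 != 1.

Lemma qbr_neq0 n : qbr q n.+1 != 0.
Proof. by rewrite /qbr subr_eq0 eq_sym q_nonroot. Qed.

Lemma qfact_neq0 n : qfact n != 0.
Proof. by apply/prodf_neq0 => i _; apply: qbr_neq0. Qed.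

Lemma qselect_qfact n m :
  qselect q true n.+1 m * qfact m * qfact n = qfact (n + m).
Proof.
elim: m => [|m IHm]; first by rewrite qselect0 qfact0 addn0 !mul1r.
by rewrite addnS !qfactS -IHm -addSn -mulrA mulrA [qfact m * _]mulrC !mulrA
  [_ * qbr q m.+1]mulrC (qselect_multi q n.+1 m).1; ring.
Qed.

Lemma qfact_rise n m :
  qfact (n + m) * qbr q n = qselect q true n m * qfact m * qfact n * qbr q (n + m).
Proof.
case: n => [|n]; last by rewrite addSn !qfactS -qselect_qfact; ring.
rewrite qbr0 qselect0n add0n; case: m => [|m] /=; rewrite ?qbr0; ring.
Qed.

(* For positive [n0] and [n] this compares [qfact (n0 - 1) * P] with
   [qfact (n + x - 1) * Q]; the extra factors [qbr q n0] and [qbr q (n + x)] make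
   it hold at 0 as well. *)
Lemma qfact_rise_step n0 n x y P Q :
  qfact n0 * P * qbr q (n + y) = qfact (n + y) * Q * qbr q n0 ->
  qfact n0 * (P * (qselect q true n x * qfact x)) * qbr q (n + x)
  = qfact (n + x) * (Q * (qselect q true n y * qfact y)) * qbr q n0.
Proof.
case: n => [|n] H.
  rewrite !qselect0n; case: x => [|x]; case: y H => [|y];
    rewrite ?add0n ?qbr0 ?qfact0 /= ?mul1r ?mulr1 ?mulr0 ?mul0r // => H.
  - by rewrite mulr0 mul0r.
  - by rewrite !mulr0 mul0r -mulrA -H mulr0.
  - by rewrite !mulr0 !mul0r.
apply: (mulfI (qbr_neq0 n)); apply: (mulfI (qbr_neq0 (n + y))).
have hx := qfact_rise n.+1 x; have hy := qfact_rise n.+1 y.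
rewrite -addSn.
transitivity (qfact n0 * P * qbr q (n.+1 + y) * qbr q n.+1 * qbr q (n.+1 + x)
   * (qselect q true n.+1 x * qfact x)); first by ring.
rewrite H.
transitivity (qfact (n.+1 + y) * qbr q n.+1 * (Q * qbr q n0 * qbr q (n.+1 + x)
   * (qselect q true n.+1 x * qfact x))); first by ring.
rewrite hy.
transitivity ((qfact (n.+1 + x) * qbr q n.+1) * (qbr q (n.+1 + y)
  * (Q * (qselect q true n.+1 y * qfact y)) * qbr q n0)); last by ring.
by rewrite hx; ring.
Qed.

End GaussInt.

(** * Inserting the copies of one letter *)

Section InsertBefore.

Variables (K : comNzRingType) (q : K) (T : eqType) (R : rel T).
Variables (f : T -> T -> nat) (xe e : T) (A : pred T).
Local Notation G := (word_sum q R f xe).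

(** The first half permits deleting an [e] between [u] and [v]; the second says that a legal gap
    never rejects [e] on both sides. Hence the gaps that accept [e] alternate with the letters
    compatible with [e] on both sides. *)
Definition bridged u v := (R u e && R e v ==> R u v) && (R u v ==> R u e || R e v).

Definition bridged_all u := forall v, A v || (v == xe) -> bridged u v.

Hypothesis Ae : A e = false.
Hypothesis A_bridged : forall u, A u -> bridged_all u.
Hypothesis A_side : forall u, A u -> R u e || R e u.
Hypothesis f_before : forall u, A u -> f u e = (R u e && R e u).
Hypothesis f_after : forall u, A u -> f e u = 0%N.
Hypothesis f_self : f e e = 0%N.

Let inner (u : T) := R u e && R e u.

Lemma count_rem_inner v S : v \in S -> count inner S = (inner v + count inner (rem v S))%N.
Proof. by move=> vS; rewrite (permP (perm_to_rem vS)). Qed.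

Lemma all_rem v (S : seq T) : all A S -> all A (rem v S).
Proof. by move=> h; apply/allP => x /mem_rem; apply: (allP h). Qed.

(** If [u] cannot precede [e], the next letter [v] satisfies [R e v]; not being [inner], it cannot
    precede [e] either. The obstruction propagates to the end, where it contradicts [~~ R e xe]. *)
Lemma word_sum_blocked S u : all A S -> bridged_all u -> ~~ R u e ->
  count inner S = 0%N -> ~~ R e xe -> G u S = 0.
Proof.
have [n] := ubnP (size S); elim: n S u => // n IHn S u leSn hA hu nue c0 nex.
have [->|Sn] := eqVneq S [::].
  rewrite word_sum_nil; have /andP[_] := hu xe (introT orP (or_intror (eqxx _))).
  by rewrite (negbTE nue) (negbTE nex) implybF => /negbTE ->.
rewrite word_sum_rec // big_seq big1 // => v; rewrite mem_undup => vS.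
have Av := allP hA _ vS.
have /andP[_] := hu v (introT orP (or_introl Av)).
rewrite (negbTE nue) /=; case Ruv: (R u v); rewrite ?mul0r //= => Rev.
rewrite IHn ?mulr0 //.
- by rewrite size_rem //; case: (S) leSn vS.
- exact: all_rem.
- exact: A_bridged.
- by move: c0; rewrite (count_rem_inner vS) /inner Rev andbT; case: (R v e).
by move: c0; rewrite (count_rem_inner vS); lia.
Qed.

(* In a path without [e], exactly one gap between two consecutive [inner] letters
   can receive copies of [e], and the number of [inner] letters before that gap
   is the weight of each copy.  Before the first and after the last [inner]
   letter there is such a gap iff [R u e], resp. [R e xe].  A gap can receive
   several copies iff [R e e]. *)
Lemma word_sum_insert_before S u m : all A S -> bridged_all u ->
  G u (nseq m e ++ S) =
    q ^+ (m * ~~ R u e)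
    * qselect q (R e e) (R u e + count inner S + R e xe).-1 m * G u S.
Proof.
have [n] := ubnP (size S); elim: n S u m => // n IHn S u m leSn hA hu.
case: m => [|m]; first by rewrite qselect0 mul0n expr0 !mul1r.
have eS : e \notin S by apply: contraFN Ae => /(allP hA).
set C := (count inner S + R e xe)%N.
(* Inner letters and letters with [R e v] only give the same factor: its power of q comes from
   [f v e] for the former and from [~~ R v e] for the latter. *)
have step w k :
    \sum_(v <- undup S) (R w v)%:R * q ^+ (k.+1 * f v e + \sum_(y <- rem v S) f v y)
        * G v (nseq k.+1 e ++ rem v S) =
    \sum_(v <- undup S) (R w v)%:R * q ^+ (\sum_(y <- rem v S) f v y)
      * (if R e v then q ^+ k.+1 * qselect q (R e e) C.-1 k.+1
         else qselect q (R e e) C k.+1) * G v (rem v S).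
  apply: eq_big_seq => v; rewrite mem_undup => vS.
  have Av := allP hA _ vS.
  case Rwv: (R w v); last by rewrite !mul0r.
  rewrite !mul1r IHn ?all_rem //; last 2 first.
  - by rewrite size_rem //; case: (S) leSn vS.
  - exact: A_bridged.
  rewrite f_before // /C (count_rem_inner vS) /inner.
  by have := A_side Av; case: (R v e); case: (R e v) => //= _;
     rewrite !(muln0, muln1, exprD, expr0); ring.
have blocked : C = 0%N -> G e S = 0.
  rewrite /C => C0; have [->|Sn] := eqVneq S [::].
    by rewrite word_sum_nil; case: (R e xe) C0; rewrite // addn1.
  rewrite word_sum_rec // big_seq big1 // => v; rewrite mem_undup => vS.
  have Av := allP hA _ vS.
  case Rev: (R e v); last by rewrite !mul0r.
  move: C0; rewrite (count_rem_inner vS) /inner Rev andbT => C0.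
  rewrite word_sum_blocked ?mulr0 ?all_rem //; first exact: A_bridged.
  - by case: (R v e) C0.
  - by move: C0; rewrite /inner; lia.
  - by case: (R e xe) C0; rewrite // addn1.
(* The recursion of [qselect] requires [0 < C]; the factor [G e S], zero by [blocked] when [C = 0],
   covers the remaining case. *)
have key k : ((if R e e then qselect q (R e e) C k
               else q ^+ k * qselect q (R e e) C.-1 k)
      + q ^+ k.+1 * qselect q (R e e) C.-1 k.+1) * G e S
    = qselect q (R e e) C k.+1 * G e S.
  have [/blocked ->|C0] := posnP C; rewrite ?mulr0 //.
  by rewrite -(prednK C0) /=; case: (R e e); rewrite ?qmultiSS ?qsubsetSS; ring.
have endE k : G e (nseq k e ++ S) =
   (if R e e then qselect q (R e e) C k else q ^+ k * qselect q (R e e) C.-1 k) * G e S.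
  elim: k => [|k IHk]; first by rewrite !qselect0 expr0 mul1r if_same mul1r.
  rewrite word_sum_insert // f_self muln0 big_seq big1 ?addn0 ?expr0 ?mulr1; last first.
    by move=> y yS; rewrite f_after // (allP hA).
  rewrite IHk step.
  set X := (\sum_(v <- _) _).
  have -> : X = q ^+ k.+1 * qselect q (R e e) C.-1 k.+1 * G e S.
    rewrite /X; have [S0|Sn] := eqVneq S [::].
      rewrite /C S0 big_nil word_sum_nil /= add0n.
      by case: (R e xe); rewrite ?mulr0 //= mul0r.
    rewrite (word_sum_rec _ _ _ _ e Sn) mulr_sumr; apply: eq_bigr => v _.
    by case: (R e v); rewrite ?mul0r ?mulr0 //; ring.
  by move: (key k); case: (R e e) => [<-|_] /=; ring.
rewrite word_sum_insert // f_self muln0 big_seq big1 ?addn0 ?expr0 ?mulr1; last first.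
  by move=> y yS; rewrite f_after // (allP hA).
rewrite step endE -addnA -/C.
have [S0|Sn] := eqVneq S [::].
  have /andP[] := hu xe (introT orP (or_intror (eqxx _))).
  have := key m; rewrite S0 big_nil !word_sum_nil /C S0 /= !add0n !addr0.
  case: (R u e); case: (R e xe); case: (R u xe) => //=;
    rewrite ?mul0r ?mulr0 ?muln0 ?mul1r ?mulr1 ?qselect0n ?mulr0 ?addr0 //.
rewrite (word_sum_rec _ _ _ _ u Sn).
case Rue: (R u e).
  rewrite mul1r muln0 expr0 mul1r add1n /=.
  (* Since [R u e], bridging lets [u] precede every [v] that [e] precedes; the sum splits into these
     and the others. *)
  have split_post (F : T -> K) : \sum_(v <- undup S) (R u v)%:R * F v =
      \sum_(v <- undup S) (R e v)%:R * F v
      + \sum_(v <- undup S) (R u v && ~~ R e v)%:R * F v.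
    rewrite -big_split; apply: eq_big_seq => v /=; rewrite mem_undup => vS.
    have /andP[+ _] := hu v (introT orP (or_introl (allP hA _ vS))).
    by rewrite Rue /=; case: (R e v); case: (R u v) => //= _; ring.
  under eq_bigr do rewrite -!mulrA.
  under [in RHS]eq_bigr do rewrite -!mulrA.
  rewrite !split_post.
  have geE : G e S = \sum_(v <- undup S)
      (R e v)%:R * (q ^+ (\sum_(y <- rem v S) f v y) * G v (rem v S)).
    by rewrite word_sum_rec //; apply: eq_bigr => v _; rewrite mulrA.
  rewrite mulrDr -geE -key mulrDl -!addrA; congr (_ + _).
  rewrite geE !mulr_sumr; congr (_ + _); apply: eq_bigr => v _.
    by case: (R e v); rewrite ?mul0r ?mulr0 //; ring.
  by case: (R e v); case: (R u v); rewrite ?mul0r ?mulr0 //=; ring.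
rewrite mul0r add0r muln1 add0n mulr_sumr; apply: eq_big_seq => v; rewrite mem_undup => vS.
have /andP[_] := hu v (introT orP (or_introl (allP hA _ vS))).
rewrite Rue /=; case: (R u v) => /= [->|_]; rewrite ?mul0r ?mulr0 //; ring.
Qed.

End InsertBefore.

Section InsertAfter.

Variables (K : comNzRingType) (q : K) (T : eqType) (R : rel T).
Variables (f : T -> T -> nat) (xe e : T) (A : pred T).
Local Notation G := (word_sum q R f xe).

Definition absorbing u := R u e -> forall v, A v || (v == xe) -> R u v.

Hypothesis Ae : A e = false.
Hypothesis A_absorbing : forall u, A u -> absorbing u.
Hypothesis e_absorbing : forall v, [|| A v, v == xe | v == e] -> R e v.
Hypothesis f_before : forall u, A u -> f u e = 0%N.
Hypothesis f_after : forall u, A u -> f e u = R u e.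
Hypothesis f_self : f e e = 0%N.

(** The slots for [e] lie right after the letters, including the start, that may precede [e];
    absorption keeps the word legal and allows repetition. A copy weighs the number of such letters
    to its right, so the slot after the start is the heaviest and [qselect_multi_last] is the
    matching recursion. *)
Lemma word_sum_insert_after S u m : all A S -> absorbing u ->
  G u (nseq m e ++ S) =
    qselect q true (R u e + count (R^~ e) S) m * G u S.
Proof.
have [n] := ubnP (size S); elim: n S u m => // n IHn S u m leSn hA hu.
have eS : e \notin S by apply: contraFN Ae => /(allP hA).
have after_e : (\sum_(y <- S) f e y)%N = count (R^~ e) S.
  rewrite -sum1_count [RHS]big_mkcond.
  by apply: eq_big_seq => y /(allP hA) /f_after ->; case: (R y e).
have step w k : \sum_(v <- undup S) (R w v)%:R
      * q ^+ (k.+1 * f v e + \sum_(y <- rem v S) f v y) * G v (nseq k.+1 e ++ rem v S) =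
    qselect q true (count (R^~ e) S) k.+1 * (if S == [::] then 0 else G w S).
  case: (eqVneq S [::]) => [->|Sn]; first by rewrite big_nil mulr0.
  rewrite word_sum_rec // mulr_sumr; apply: eq_big_seq => v; rewrite mem_undup => vS.
  have Av := allP hA _ vS.
  rewrite IHn; first last.
  - exact: A_absorbing.
  - by apply/allP => x /mem_rem; apply: (allP hA).
  - by rewrite size_rem //; case: (S) leSn vS.
  rewrite f_before // muln0 add0n (permP (perm_to_rem vS)) /=; ring.
have same w : absorbing w -> R w e -> G w S = G e S.
  move=> hw Rwe; have [->|Sn] := eqVneq S [::].
    by rewrite !word_sum_nil (hw Rwe) ?eqxx ?orbT // e_absorbing // eqxx orbT.
  apply: word_sum_start => // v vS; have Av := allP hA _ vS.
  by rewrite (hw Rwe) ?Av // e_absorbing // Av.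
have endE k : G e (nseq k e ++ S) = qselect q true (count (R^~ e) S).+1 k * G e S.
  elim: k => [|k IHk]; first by rewrite qselect0 mul1r.
  rewrite word_sum_insert // IHk f_self muln0 add0n after_e step.
  rewrite e_absorbing ?eqxx ?orbT // qselect_multi_last.
  by case: (eqVneq S [::]) => [->|Sn] /=; rewrite ?qselect0n /=; ring.
case: m => [|m]; first by rewrite qselect0 mul1r.
rewrite word_sum_insert // endE f_self muln0 add0n after_e step.
case Rue: (R u e).
  rewrite -(same u) // add1n qselect_multi_last.
  by case: (eqVneq S [::]) => [->|Sn] /=; rewrite ?qselect0n /=; ring.
by case: (eqVneq S [::]) => [->|Sn] /=; rewrite ?qselect0n /=; ring.
Qed.

End InsertAfter.

(** * Words of north steps and the three kinds of insertion *)

(* The level of a north step is [a_j + s + 1]; the shift by 1 leaves room for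
   [start_letter] below the lowest diagonal. *)
Notation letter := (nat * nat * bool)%type.

Definition lv (x : letter) : nat := x.1.1.
Definition lb (x : letter) : nat := x.1.2.
Definition mk (x : letter) : bool := x.2.

(** Gathers the conditions on two consecutive north steps: geometry of the path, labelling, and
    contractibility when [v] is decorated. *)
Definition follows (u v : letter) : bool :=
  [&& (lv v <= (lv u).+1)%N,
      (lv v == (lv u).+1) ==> (lb u < lb v)%N
    & mk v ==> (lv v < lv u)%N || (lv v == lv u) && (lb u < lb v)%N].

Definition inverts (u v : letter) : bool :=
  ~~ mk u && ((lv u == lv v) && (lb u < lb v)%N
              || (lv u == (lv v).+1) && (lb v < lb u)%N).

Definition inv_stat (u v : letter) : nat := inverts u v.

Lemma letter_eqE (u v : letter) :
  (u == v) = [&& lv u == lv v, lb u == lb v & mk u == mk v].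
Proof. by case: u v => [[a b] x] [[a' b'] x']; rewrite andbA. Qed.

(* The path starts with [a_1 <= 0] iff it can follow an unmarked 0 on the diagonal
   [a = -1]; the exceptional rules of the labelling and of contractibility at the
   first north step are then the general ones.  Likewise it ends with
   [a_N >= 0] iff it can be followed by a large label on [a = 1]. *)
Definition start_letter (c : nat) : letter := (c, 0%N, false).
Definition end_letter (M c : nat) : letter := (c.+2, M.+1, false).

Lemma perm_split_class (T : eqType) (e : T) (S : seq T) :
  perm_eq S (nseq (count_mem e S) e ++ filter (predC1 e) S).
Proof.
rewrite -(perm_filterC (pred1 e)) perm_cat2r.
by have /all_pred1P -> := filter_all (pred1 e) S; rewrite size_filter.
Qed.

Ltac letter_lia :=
  rewrite ?letter_eqE /bridged /inv_stat /inverts /follows /lv /lb /mk /=; lia.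

Section LetterInsertion.

Variables (K : comNzRingType) (q : K).
Implicit Types (u v e xe : letter) (S : seq letter).

Local Notation G := (word_sum q follows inv_stat).

(** A marked letter cannot follow itself, so subsets of gaps are chosen. The letters compatible with
    [e] on both sides are exactly those that invert [e]. *)
Lemma insert_marked e xe u S m : mk e -> e \notin S ->
  G xe u (nseq m e ++ S) =
    q ^+ (m * ~~ follows u e)
    * qselect q false (follows u e + count (inverts^~ e) S + follows e xe).-1 m
    * G xe u S.
Proof.
case: e => [[i c] [|]] // _; set e := (i, c, true) => eS.
have ee : follows e e = false by letter_lia.
have brd w v : bridged follows e w v.
  by case: w => [[a b] x]; case: v => [[a' b'] [|]]; letter_lia.
have inner x : x != e -> (follows x e && follows e x) = inverts x e.
  by case: x => [[a b] [|]]; letter_lia.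
have neS x : x \in S -> x != e by move=> xS; apply: contraNneq eS => <-.
have cntE : count (fun x => follows x e && follows e x) S = count (inverts^~ e) S.
  by apply: eq_in_count => x /neS /inner.
have := @word_sum_insert_before _ q _ follows inv_stat xe e (predC1 e) _ _ _ _ _ _ S u m.
rewrite ee cntE; apply => //.
- by rewrite /= eqxx.
- by move=> w _ v _; apply: brd.
- by case=> [[a b] [|]] /=; letter_lia.
- by move=> x /inner xe_; rewrite /inv_stat -xe_.
exact/allP.
Qed.

(** Here [e] is the smallest label on the highest level of an unmarked word, so it may precede every
    letter and itself. It inverts exactly the letters that it can follow. *)
Lemma insert_top e xe u S m :
  ~~ mk e ->
  {in S, forall x, [&& ~~ mk x, (lv x <= lv e)%N,
                       (lv x == lv e) ==> (lb e < lb x)%N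
                     & follows x e ==> follows x xe]} ->
  follows e xe ->
  (follows u e -> follows u xe /\ {in S, forall x, follows u x}) ->
  G xe u (nseq m e ++ S) =
    qselect q true (follows u e + count (follows^~ e) S) m * G xe u S.
Proof.
case: e => [[i c] [|]] // _; set e := (i, c, false) => hS exe hu.
have eS : e \notin S by apply/negP => /hS; letter_lia.
apply: (@word_sum_insert_after _ q _ follows inv_stat xe e (mem S)).
- exact: negbTE.
- move=> x xS xe_ y /orP[yS|/eqP ->]; last by case/and4P: (hS _ xS) => _ _ _; rewrite xe_.
  move: x xS xe_ => [[a b] [|]] /hS; move: y yS => [[a' b'] [|]] /hS; letter_lia.
- move=> y /or3P[yS|/eqP -> //|/eqP ->]; last by letter_lia.
  by move: y yS => [[a' b'] [|]] /hS; letter_lia.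
- by move=> [[a b] [|]] /hS; letter_lia.
- by move=> [[a b] [|]] /hS; letter_lia.
- by letter_lia.
- exact/allP.
by move=> /hu[h1 h2] y /orP[/h2|/eqP ->].
Qed.

(** Here [e] is the largest label on the lowest level of an unmarked word, so every letter may
    precede it; the letters that it may precede are the inner ones. The end lies too high to follow
    [e]. *)
Lemma insert_bottom e xe u S m :
  ~~ mk e ->
  {in S, forall x, [&& ~~ mk x, (lv e <= lv x)%N
                     & (lv x == lv e) ==> (lb x < lb e)%N]} ->
  ((lv e).+1 < lv xe)%N -> (lv e <= lv u)%N ->
  (lv u == lv e) ==> (lb u <= lb e)%N ->
  G xe u (nseq m e ++ S) = qselect q true (count (follows e) S) m * G xe u S.
Proof.
case: e => [[i c] [|]] // _; set e := (i, c, false) => hS hxe hu1 hu2.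
have eS : e \notin S by apply/negP => /hS; letter_lia.
have pre x : (lv e <= lv x)%N -> follows x e by case: x => [[a b] y]; letter_lia.
have preS x : x \in S -> follows x e by move=> /hS/and3P[_ /pre].
have brd x : (lv e <= lv x)%N -> (lv x == lv e) ==> (lb x <= lb e)%N ->
    bridged_all follows xe e (mem S) x.
  move=> h1 h2 v /orP[/hS|/eqP ->].
    by case: x h1 h2 => [[a b] y]; case: v => [[a' b'] [|]]; letter_lia.
  by rewrite /bridged pre //; move: hxe; case: (xe) => [[a' b'] z]; letter_lia.
have := @word_sum_insert_before _ q _ follows inv_stat xe e (mem S) _ _ _ _ _ _ S u m.
have -> : follows e xe = false by move: hxe; case: (xe) => [[a' b'] z]; letter_lia.
have -> : follows e e by letter_lia.
rewrite pre // muln0 expr0 mul1r addn0 add1n /=.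
have -> : count (fun x => follows x e && follows e x) S = count (follows e) S.
  by apply: eq_in_count => x /preS ->.
apply.
- exact: negbTE.
- move=> x /hS/and3P[_ h1 h2]; apply: brd => //.
  by case: eqP h2 => //= _ /ltnW.
- by move=> x /preS ->.
- by move=> x /[dup] /preS -> /hS; case: x => [[a b] [|]]; letter_lia.
- by move=> [[a b] [|]] /hS; letter_lia.
- by letter_lia.
- exact/allP.
exact: brd.
Qed.

End LetterInsertion.

(** * Moving the cut by one diagonal *)

Section CutRelation.

Variables (K : fieldType) (q : K) (M : nat).
Implicit Types (e u : letter) (S : seq letter).

Definition cut_sum (c : nat) (S : seq letter) : K :=
  word_sum q follows inv_stat (end_letter M c) (start_letter c) S.

Definition nz_unmarked (i : nat) (S : seq letter) : nat :=
  count (fun x => [&& lv x == i, (0 < lb x)%N & ~~ mk x]) S.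

Definition nz_marked (i : nat) (S : seq letter) : nat :=
  count (fun x => [&& lv x == i, (0 < lb x)%N & mk x]) S.

Definition zero_marked (i : nat) (S : seq letter) : nat :=
  count (fun x => [&& lv x == i, lb x == 0%N & mk x]) S.

(** A level is a diagonal plus one: unmarked letters are taken from diagonal [i], marked zeros from
    diagonal [i - 1]. *)
Definition slots (i : nat) (S : seq letter) : int :=
  (nz_unmarked i.+1 S)%:Z - (zero_marked i S)%:Z.

(* The theorem for [s = k + 1] with denominators cleared, in terms of inversions
   alone: the power of q is the change of the bonus between the two cuts divided by
   the power of q in the theorem. *)
Definition cut_relation (k : nat) (S : seq letter) : Prop :=
  qbrz q (slots k S) * q ^+ (nz_marked k.+1 S + zero_marked k S) * cut_sum k.+1 S
  = qbrz q (slots k.+1 S) * cut_sum k S.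

Lemma perm_cut_relation k S S' : perm_eq S S' -> cut_relation k S -> cut_relation k S'.
Proof.
move=> h; rewrite /cut_relation /slots /nz_marked /nz_unmarked /zero_marked /cut_sum.
by rewrite !(permP h) !(perm_word_sum _ _ _ _ _ h).
Qed.

Lemma follows_start w i c :
  follows (start_letter w) (i, c, true) = (i < w)%N || (i == w) && (0 < c)%N.
Proof. by letter_lia. Qed.

Lemma follows_end w i c b : (c <= M)%N -> follows (i, c, b) (end_letter M w) = (w < i)%N.
Proof. by letter_lia. Qed.

(** The factors of [insert_marked] for the two cuts differ only on levels [k] and [k.+1]. A nonzero
    letter on [k.+1] yields an extra [q ^+ m] for the lower cut, matched by [nz_marked]. A zero on
    either level changes the number of gaps by one, which [qselect_pred] converts into the change of
    [slots]; on level [k] the exponent [zero_marked] matches the power of q. *)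
Lemma cut_relation_marked k m e S :
  mk e -> (lb e <= M)%N -> e \notin S ->
  cut_relation k S -> cut_relation k (nseq m e ++ S).
Proof.
case: e => [[i c] [|]] // _ cM; set e := (i, c, true) => eS.
have nu j : nz_unmarked j (nseq m e ++ S) = nz_unmarked j S.
  by rewrite /nz_unmarked count_cat count_nseq !andbF.
have nm j : nz_marked j (nseq m e ++ S) =
    ((if (j == i) && (0 < c)%N then m else 0) + nz_marked j S)%N.
  rewrite /nz_marked count_cat count_nseq /e /lv /lb /mk /= andbT eq_sym.
  by case: ifP; rewrite ?mul1n ?mul0n.
(* All copies of a letter leave at once, so no marked zero remains on its level. *)
have z0 : c = 0%N -> zero_marked i S = 0%N.
  move=> c0; apply/eqP; rewrite -leqn0 leqNgt -has_count.
  apply/hasPn => x xS; apply/negP => /and3P[h1 h2 h3]; move/negP: eS; apply.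
  rewrite (_ : e = x) //; apply/eqP; rewrite letter_eqE /e c0.
  by move: h1 h2 h3; rewrite /lv /lb /mk /= => /eqP -> /eqP -> ->; rewrite !eqxx.
have zm j : zero_marked j (nseq m e ++ S) =
    (if (j == i) && (c == 0%N) then m else zero_marked j S)%N.
  rewrite /zero_marked count_cat count_nseq /e /lv /lb /mk /= andbT eq_sym.
  case: ifP => [/andP[/eqP -> /eqP c0]|_]; rewrite ?mul1n ?mul0n //.
  by rewrite -/(zero_marked i S) z0 // addn0.
have hn : c = 0%N -> count (inverts^~ e) S = nz_unmarked i.+1 S.
  move=> c0; apply: eq_count => -[[a b] x]; rewrite /e c0 /inverts /lv /lb /mk /=; lia.
rewrite /cut_relation /cut_sum !insert_marked // /slots !nu nm !zm.
set n := count _ S.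
rewrite !follows_start follows_end // follows_end //.
set Gh := word_sum _ _ _ _ (start_letter k.+1) _.
set Gl := word_sum _ _ _ _ (start_letter k) _ => IH.
(* Each case multiplies the relation for [S] by a common factor [s]. *)
have scaled (s r l : K) :
    l = qbrz q (slots k S) * q ^+ (nz_marked k.+1 S + zero_marked k S) * Gh * s ->
    qbrz q (slots k.+1 S) * Gl * s = r -> l = r.
  by rewrite -IH => ->.
rewrite /slots in scaled; have [ik|ki|ik] := ltngtP i k.
- rewrite (gtn_eqF (leqW ik)) (leqW ik).
  rewrite (_ : (k.+1 < i)%N = false) /=; last by lia.
  rewrite muln0 expr0 !addn0 !add0n !mul1r.
  by apply: (scaled (qselect q false n m)); ring.
- rewrite (_ : (i < k.+1)%N = false) /=; last by lia.
  have [ik|ki1] := eqVneq i k.+1; last first.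
    rewrite (_ : (k.+1 < i)%N) /=; last by lia.
    rewrite !muln1 !add0n addn1.
    by apply: (scaled (q ^+ m * qselect q false n m)); ring.
  rewrite ik ltnn /=; case: (posnP c) => [c0|c0] /=.
    have := z0 c0; rewrite ik => z0k; rewrite z0k subr0 qbrz_nat in scaled.
    rewrite !add0n !addn0 addn1 !muln1 /= /n hn // ik.
    have P := qselect_pred q (nz_unmarked k.+2 S) m.
    apply: (scaled (q ^+ m * qselect q false (nz_unmarked k.+2 S).-1 m)); first by ring.
    transitivity (q ^+ m * Gl * (qbr q (nz_unmarked k.+2 S) *
      qselect q false (nz_unmarked k.+2 S).-1 m)); [by ring | by rewrite -P; ring].
  rewrite muln0 !muln1 !addn0 !add0n addn1 expr0.
  apply: (scaled (q ^+ m * qselect q false n m)); last by ring.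
  by rewrite !exprD; ring.
rewrite ik (_ : (k.+1 == k) = false); last by lia.
rewrite (_ : (k.+1 < k)%N = false) ?ltnSn /=; last by lia.
case: (posnP c) => [c0|c0] /=; last first.
  rewrite muln0 !addn0 !add0n expr0.
  by apply: (scaled (qselect q false n m)); ring.
have := z0 c0; rewrite ik => z0k; rewrite z0k subr0 qbrz_nat addn0 in scaled.
rewrite !add0n !addn0 muln0 !muln1 expr0 /= /n hn // ik.
have P := qselect_pred q (nz_unmarked k.+1 S) m.
apply: (scaled (q ^+ m * qselect q false (nz_unmarked k.+1 S).-1 m)); last by ring.
transitivity (q ^+ m * Gh * q ^+ nz_marked k.+1 S * (qbr q (nz_unmarked k.+1 S) *
      qselect q false (nz_unmarked k.+1 S).-1 m)); last by ring.
by rewrite -P exprD; ring.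
Qed.

End CutRelation.

(** * Unmarked words on one and two levels *)

Definition mult (S : seq letter) (i v : nat) : nat :=
  count_mem ((i, v, false) : letter) S.

Lemma count_split (T : eqType) (P Q Z : pred T) (S : seq T) :
  {in S, forall x, (P x == Q x || Z x) && ~~ (Q x && Z x)} ->
  count P S = (count Q S + count Z S)%N.
Proof.
elim: S => //= x S IHS hS; rewrite IHS => [|y yS]; last by rewrite hS // in_cons yS orbT.
have /andP[/eqP -> ] := hS x (mem_head _ _); case: (Q x); case: (Z x) => //= _; lia.
Qed.

Lemma peel_class (S : seq letter) (P Q : pred letter) (e : letter) :
  P e -> {in S, Q =1 predI (predC1 e) P} ->
  perm_eq (filter P S) (nseq (count_mem e S) e ++ filter Q S).
Proof.
move=> Pe QE; rewrite (permPl (perm_split_class e _)) -filter_predI count_filter.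
rewrite -(eq_in_filter QE) (_ : count _ S = count_mem e S) //.
by apply: eq_count => x /=; case: eqP => // ->; rewrite Pe.
Qed.


Section OneLevel.

Variables (K : fieldType) (q : K) (M j : nat).

Definition flat (S : seq letter) : Prop :=
  {in S, forall x, [&& lv x == j.+1, (lb x <= M)%N & ~~ mk x]}.

(** With a start on the same level every arrangement is legal, so the sum is a q-multinomial
    coefficient. The labels are peeled off from the smallest on. *)
Lemma flat_word_sum S : flat S ->
  word_sum q follows inv_stat (end_letter M j) (j.+1, 0%N, false) S
    * \prod_(v < M.+1) qfact q (mult S j.+1 v) = qfact q (size S).
Proof.
move=> hS; pose tail V := filter (fun x => V <= lb x)%N S.
have H d V : (V + d = M.+1)%N ->
    word_sum q follows inv_stat (end_letter M j) (j.+1, 0%N, false) (tail V)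
    * \prod_(V <= v < M.+1) qfact q (mult S j.+1 v) = qfact q (size (tail V)).
  elim: d V => [|d IHd] V VM.
    rewrite (_ : tail V = [::]); last first.
      by rewrite -(filter_pred0 S); apply: eq_in_filter => x /hS/and3P[_ + _] /=; lia.
    rewrite word_sum_nil big_geq; last by lia.
    by rewrite qfact0 mulr1 (_ : follows _ _ = true) //; letter_lia.
  have VM' : (V <= M)%N by lia.
  set e : letter := (j.+1, V, false).
  have hp : perm_eq (tail V) (nseq (mult S j.+1 V) e ++ tail V.+1).
    apply: peel_class => [|[[a b] [|]] /hS]; rewrite /= ?letter_eqE /lv /lb /mk /=; lia.
  rewrite (perm_word_sum _ _ _ _ _ hp) (perm_size hp) insert_top //; last 3 first.
  - case=> [[a b] [|]]; rewrite mem_filter => /andP[+ /hS]; rewrite /follows /lv /lb /mk /=; lia.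
  - by rewrite /follows /lv /lb /mk /=; lia.
  - move=> _; split; first by rewrite /follows /lv /lb /mk /=; lia.
    by case=> [[a b] [|]]; rewrite mem_filter => /andP[+ /hS]; rewrite /follows /lv /lb /mk /=; lia.
  rewrite big_ltn; last by lia.
  rewrite size_cat size_nseq (addnC (mult _ _ _)) -qselect_qfact // -IHd; last by lia.
  rewrite (_ : count _ _ = size (tail V.+1)); last first.
    apply/eqP; rewrite -all_count; apply/allP => -[[a b] [|]].
      by rewrite mem_filter => /andP[_ /hS/and3P[]].
    by rewrite mem_filter => /andP[+ /hS]; rewrite /follows /lv /lb /mk /=; lia.
  rewrite (_ : follows _ _ = true) ?add1n; last by rewrite /follows /lv /lb /mk /=; lia.
  by ring.
have := H M.+1 0%N (add0n _).
rewrite big_mkord (_ : tail 0%N = S) //.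
by rewrite -[RHS]filter_predT; apply: eq_filter.
Qed.

(** The start now lies one level lower, so the word cannot begin with a zero. The zeros lose the
    slot at the start, which trades the bracket of the size for that of the number of nonzero
    labels. *)
Lemma flat_cut_sum S : flat S ->
  cut_sum q M j S * \prod_(v < M.+1) qfact q (mult S j.+1 v)
  = qbr q (count (fun x => 0 < lb x)%N S) * qfact q (size S).-1.
Proof.
move=> hS; set e : letter := (j.+1, 0%N, false).
pose S' := filter (fun x => 0 < lb x)%N S.
have hS' : flat S' by move=> x; rewrite mem_filter => /andP[_ /hS].
have hp : perm_eq S (nseq (mult S j.+1 0) e ++ S').
  rewrite -{1}[S]filter_predT; apply: peel_class => // -[[a b] [|]] /hS;
  by rewrite /= ?letter_eqE /lv /lb /mk /=; lia.
rewrite /cut_sum (perm_word_sum _ _ _ _ _ hp) insert_top //; last 3 first.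
- case=> [[a b] [|]]; rewrite mem_filter => /andP[+ /hS]; rewrite /follows /lv /lb /mk /=; lia.
- by rewrite /follows /lv /lb /mk /=; lia.
- by rewrite /follows /lv /lb /mk /=; lia.
have -> : follows (start_letter j) e = false by rewrite /follows /lv /lb /mk /=; lia.
rewrite -[count (fun x => 0 < _)%N S]size_filter -/S' (perm_size hp) size_cat size_nseq add0n.
rewrite (_ : count _ _ = size S'); last first.
  apply/eqP; rewrite -all_count; apply/allP => -[[a b] [|]].
    by rewrite mem_filter => /andP[_ /hS/and3P[]].
  by rewrite mem_filter => /andP[+ /hS]; rewrite /follows /lv /lb /mk /=; lia.
(* With zeros only, no word is legal and both sides vanish. *)
have [S0|Sn] := eqVneq S' [::].
  have -> : word_sum q follows inv_stat (end_letter M j) (start_letter j) S' = 0.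
    by rewrite S0 word_sum_nil (_ : follows _ _ = false) //; letter_lia.
  by rewrite S0 /= qbr0 !(mulr0, mul0r).
rewrite (@word_sum_start _ _ _ _ _ _ (start_letter j) e) //; last first.
  by case=> [[a b] [|]]; rewrite mem_filter => /andP[+ /hS]; rewrite /follows /lv /lb /mk /=; lia.
have hm (v : 'I_M) : mult S j.+1 (lift ord0 v) = mult S' j.+1 (lift ord0 v).
  by rewrite /mult (permP hp) count_cat count_nseq /= letter_eqE andbF.
have := flat_word_sum hS'; rewrite !big_ord_recl.
rewrite (_ : mult S' _ ord0 = 0%N) ?qfact0 ?mul1r; last first.
  by apply/count_memPn; rewrite mem_filter.
under [in X in _ -> X]eq_bigr do rewrite hm.
move: Sn; rewrite -size_eq0; case: (size S') => // n _ /= IH.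
rewrite qfactS in IH; rewrite addnS /= (addnC (mult _ _ _)) -qselect_qfact //.
transitivity (qselect q true n.+1 (mult S j.+1 0) * qfact q (mult S j.+1 0)
  * (qfact q n * qbr q n.+1)); last by ring.
by rewrite -IH /e; ring.
Qed.

End OneLevel.

Section TwoLevels.

Variables (K : fieldType) (q : K) (M k : nat) (S : seq letter).

Hypothesis S_levels : {in S, forall x,
  [&& (lv x == k.+1) || (lv x == k.+2), (lb x <= M)%N & ~~ mk x]}.

(** The numbers [n_c] of the telescoping argument: the slots for label [v], both when it is inserted
    on [k.+1] and when it is inserted on [k.+2]. *)
Definition straddling (v : nat) : nat :=
  count (fun x => (lv x == k.+1) && (lb x < v)%N || (lv x == k.+2) && (v < lb x)%N) S.

(** The end of this cut is two levels above [k.+1], so [insert_bottom] empties that level from the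
    largest label on. *)
Lemma cut_sum_upper : cut_sum q M k.+1 S =
  (\prod_(v < M.+1) qselect q true (straddling v) (mult S k.+1 v))
  * cut_sum q M k.+1 (filter (fun x => lv x == k.+2) S).
Proof.
have H V : cut_sum q M k.+1 (filter (fun x => (lv x == k.+2) || (lb x < V)%N) S) =
  (\prod_(v < V) qselect q true (straddling v) (mult S k.+1 v))
  * cut_sum q M k.+1 (filter (fun x => lv x == k.+2) S).
  elim: V => [|V IHV].
    by rewrite big_ord0 mul1r; congr (cut_sum _ _ _ _); apply: eq_filter => x; rewrite orbF.
  set e : letter := (k.+1, V, false).
  rewrite {1}/cut_sum (perm_word_sum _ _ _ _ _ (peel_class (e := e)
    (Q := fun x => (lv x == k.+2) || (lb x < V)%N) _ _)); last 2 first.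
  - by rewrite /lb /=; lia.
  - by case=> [[a b] [|]] /S_levels; rewrite /= letter_eqE /lv /lb /mk /=; lia.
  rewrite insert_bottom //; last 2 first.
  - by case=> [[a b] [|]]; rewrite mem_filter => /andP[+ /S_levels]; rewrite /lv /lb /mk /=; lia.
  - by rewrite implybT.
  rewrite big_ord_recr /= [\prod_(v < V) _ * _]mulrC -mulrA -IHV; congr (qselect _ _ _ _ * _).
  rewrite count_filter; apply: eq_in_count => -[[a b] [|]] /S_levels.
    by rewrite /= /follows /lv /lb /mk /=; lia.
  by rewrite /= /follows /lv /lb /mk /=; lia.
rewrite -H; congr cut_sum; rewrite -[LHS]filter_predT.
apply: eq_in_filter => x /S_levels/and3P[_ + _].
by rewrite ltnS => ->; rewrite orbT.
Qed.

(** The end of this cut is on [k.+2], so [insert_top] empties that level from the smallest label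
    on. *)
Lemma cut_sum_lower : cut_sum q M k S =
  (\prod_(v < M.+1) qselect q true (straddling v) (mult S k.+2 v))
  * cut_sum q M k (filter (fun x => lv x == k.+1) S).
Proof.
have H V : cut_sum q M k S =
  (\prod_(v < V) qselect q true (straddling v) (mult S k.+2 v))
  * cut_sum q M k (filter (fun x => (lv x == k.+1) || (V <= lb x)%N) S).
  elim: V => [|V IHV].
    rewrite big_ord0 mul1r; congr (cut_sum _ _ _ _).
    by rewrite -[LHS]filter_predT; apply: eq_filter => x; rewrite orbT.
  set e : letter := (k.+2, V, false).
  rewrite IHV {1}/cut_sum (perm_word_sum _ _ _ _ _ (peel_class (e := e)
    (Q := fun x => (lv x == k.+1) || (V < lb x)%N) _ _)); last 2 first.
  - by rewrite /lb /=; lia.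
  - by case=> [[a b] [|]] /S_levels; rewrite /= letter_eqE /lv /lb /mk /=; lia.
  rewrite insert_top //; last 3 first.
  - case=> [[a b] [|]]; rewrite mem_filter => /andP[+ /S_levels].
      by rewrite /follows /lv /lb /mk /=; lia.
    by rewrite /follows /lv /lb /mk /=; lia.
  - by rewrite /follows /lv /lb /mk /=; lia.
  - by rewrite /follows /lv /lb /mk /=; lia.
  rewrite big_ord_recr /= -mulrA; congr (_ * (qselect _ _ _ _ * _)).
  rewrite count_filter /follows /lv /=.
  rewrite (_ : _ <= _ = false)%N ?add0n; last by lia.
  apply: eq_in_count => -[[a b] [|]] /S_levels; rewrite /= /follows /lv /lb /mk /=; lia.
rewrite (H M.+1); congr (_ * cut_sum _ _ _ _); apply: eq_in_filter => x /S_levels/and3P[_ + _].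
by rewrite (ltnNge M) => ->; rewrite orbF.
Qed.

Hypothesis q_nonroot : forall n, q ^+ n.+1 != 1.

Lemma two_level_products :
  let X := filter (fun x => lv x == k.+1) S in
  let Y := filter (fun x => lv x == k.+2) S in
  qfact q (size Y)
    * (\prod_(v < M.+1) (qselect q true (straddling v) (mult S k.+1 v)
                         * qfact q (mult S k.+1 v)))
    * qbr q (size X)
  = qfact q (size X)
    * (\prod_(v < M.+1) (qselect q true (straddling v) (mult S k.+2 v)
                         * qfact q (mult S k.+2 v)))
    * qbr q (size Y).
Proof.
move=> X Y.
(* [N] interpolates between [size Y] and [size X]. Both [N V] and [N V.+1] exceed [straddling V] by
   the multiplicity of [V], on the upper and on the lower level respectively, as [qfact_rise_step]
   requires. *)
pose N V := count (fun x => (lv x == k.+1) && (lb x < V)%N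
                         || (lv x == k.+2) && (V <= lb x)%N) S.
have N0 : size Y = N 0%N.
  by rewrite size_filter; apply: eq_count => x; rewrite andbF andbT.
have NM : size X = N M.+1.
  rewrite size_filter; apply: eq_in_count => -[[a b] [|]] /S_levels; rewrite /lv /lb /mk /=; lia.
rewrite N0 NM; elim: {NM}M.+1 => [|V IHV]; first by rewrite !big_ord0.
rewrite !big_ord_recr /=.
have -> : N V.+1 = (straddling V + mult S k.+1 V)%N.
  apply: count_split => -[[a b] [|]] /S_levels; rewrite /= ?letter_eqE /lv /lb /mk /=; lia.
apply: qfact_rise_step => //.
rewrite (_ : (_ + _)%N = N V) //; apply/esym.
apply: count_split => -[[a b] [|]] /S_levels; rewrite /= ?letter_eqE /lv /lb /mk /=; lia.
Qed.

Lemma cut_relation_two_levels : cut_relation q M k S.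
Proof.
have unm (P : pred letter) : count (fun x => P x && mk x) S = 0%N.
  apply/eqP; rewrite -leqn0 leqNgt -has_count.
  apply/hasPn => x /S_levels/and3P[_ _ /negbTE ->].
  by rewrite andbF.
have zm i : zero_marked i S = 0%N.
  rewrite -(unm (fun x => (lv x == i) && (lb x == 0%N))).
  by apply: eq_count => x; rewrite andbA.
have nm i : nz_marked i S = 0%N.
  rewrite -(unm (fun x => (lv x == i) && (0 < lb x)%N)).
  by apply: eq_count => x; rewrite andbA.
rewrite /cut_relation /slots !zm nm !subr0 !qbrz_nat expr0 mulr1.
rewrite cut_sum_upper cut_sum_lower.
set X := filter (fun x => lv x == k.+1) S; set Y := filter (fun x => lv x == k.+2) S.
have hX : flat M k X.
  by move=> x; rewrite mem_filter => /andP[-> /S_levels/andP[_ ->]].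
have hY : flat M k.+1 Y.
  by move=> x; rewrite mem_filter => /andP[-> /S_levels/andP[_ ->]].
have nzE i : nz_unmarked i S = count (fun x => 0 < lb x)%N (filter (fun x => lv x == i) S).
  rewrite count_filter; apply: eq_in_count => x /S_levels/and3P[_ _ ->].
  by rewrite andbT andbC.
have multE i v : mult (filter (fun x => lv x == i) S) i v = mult S i v.
  rewrite /mult count_filter; apply: eq_count => x /=.
  by case: eqP => // ->; rewrite /lv eqxx.
have := flat_cut_sum q hX; have := flat_cut_sum q hY.
rewrite -!nzE; under eq_bigr do rewrite multE; move=> EY.
under eq_bigr do rewrite multE; move=> EX.
have := two_level_products; rewrite /= -/X -/Y !big_split /=.
set hX' := \prod_(v < M.+1) qselect _ _ _ (mult S k.+1 v).
set hY' := \prod_(v < M.+1) qselect _ _ _ (mult S k.+2 v).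
set FX := \prod_(v < M.+1) _ in EX *; set FY := \prod_(v < M.+1) _ in EY * => E.
have FX0 : FX != 0 by apply/prodf_neq0 => v _; apply: qfact_neq0.
have FY0 : FY != 0 by apply/prodf_neq0 => v _; apply: qfact_neq0.
apply: (mulfI FX0); apply: (mulfI FY0).
transitivity (qbr q (nz_unmarked k.+1 S) * (hX' * FX) * (cut_sum q M k.+1 Y * FY)).
  by ring.
transitivity (qbr q (nz_unmarked k.+2 S) * (hY' * FY) * (cut_sum q M k X * FX)); last by ring.
rewrite EX EY !nzE -/X -/Y.
(* An empty level has no nonzero label, so both sides vanish; otherwise the brackets of the two
   sizes are nonzero and cancel. *)
case: X E {EX hX} => [|x X] E; first by rewrite /= qbr0; ring.
case: Y E {EY hY} => [|y Y] E; first by rewrite /= qbr0; ring.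
rewrite /= !qfactS in E *.
suff EE : qfact q (size Y) * (hX' * FX) = qfact q (size X) * (hY' * FY).
  set a := qbr q _; set b := qbr q _ in EE *.
  transitivity (a * b * (qfact q (size Y) * (hX' * FX))); first by ring.
  by rewrite EE; ring.
apply: (mulfI (qbr_neq0 q_nonroot (size X))); apply: (mulfI (qbr_neq0 q_nonroot (size Y))).
transitivity (qfact q (size Y) * qbr q (size Y).+1 * (hX' * FX) * qbr q (size X).+1).
  by ring.
by rewrite E; ring.
Qed.

End TwoLevels.

(** * Reduction to two unmarked levels *)

Lemma has_argmax (T : eqType) (P : pred T) (g : T -> nat) (S : seq T) : has P S ->
  exists2 e, e \in S & P e /\ {in S, forall x, P x -> (g x <= g e)%N}.
Proof.
elim: S => //= x S IHS hx.
have [hS|nS] := boolP (has P S); last first.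
  exists x; first exact: mem_head.
  split; first by rewrite (negbTE nS) orbF in hx.
  by move=> y; rewrite in_cons => /predU1P[->|/(hasPn nS)/negbTE ->].
have [e eS [Pe me]] := IHS hS; have [xe|ex] := boolP (P x && (g e < g x)%N).
  have /andP[Px /ltnW gx] := xe; exists x; rewrite ?mem_head //; split=> // y.
  by rewrite in_cons => /predU1P[->//|/me h /h] /leq_trans; apply.
exists e; rewrite ?in_cons ?eS ?orbT //; split=> // y.
by rewrite in_cons => /predU1P[->|/me //] Px; move: ex; rewrite Px -leqNgt.
Qed.

Section AllLevels.

Variables (K : fieldType) (q : K) (M k : nat).

Hypothesis q_nonroot : forall n, q ^+ n.+1 != 1.

Lemma cut_relation_scale m e S c : ~~ mk e -> lv e != k.+1 -> lv e != k.+2 ->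
  cut_sum q M k.+1 (nseq m e ++ S) = c * cut_sum q M k.+1 S ->
  cut_sum q M k (nseq m e ++ S) = c * cut_sum q M k S ->
  cut_relation q M k S -> cut_relation q M k (nseq m e ++ S).
Proof.
move=> me e1 e2 H1 H2; rewrite /cut_relation /slots /nz_unmarked /nz_marked /zero_marked.
rewrite !count_cat !count_nseq H1 H2 (negbTE e1) (negbTE e2) (negbTE me) !andbF !mul0n !add0n.
by move=> IH; rewrite mulrCA IH; ring.
Qed.

(** Whole classes are removed in this order: marked letters, then levels above [k.+2] from the top,
    then levels below [k.+1] from the bottom. Unmarked letters off the two middle levels give both
    cuts the same factor. *)
Lemma cut_relation_all S : {in S, forall x, (lb x <= M)%N} -> cut_relation q M k S.
Proof.
have [n] := ubnP (size S); elim: n S => // n IHn S leSn hM.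
have peel e : e \in S ->
    (cut_relation q M k (filter (predC1 e) S) ->
     cut_relation q M k (nseq (count_mem e S) e ++ filter (predC1 e) S)) ->
    cut_relation q M k S.
  move=> eS he; apply: perm_cut_relation (he _).
    by rewrite perm_sym; apply: perm_split_class.
  apply: IHn => [|x]; last by rewrite mem_filter => /andP[_ /hM].
  rewrite -ltnS (leq_trans _ leSn) // ltnS size_filter -(count_predC (pred1 e) S).
  by rewrite -[X in (X < _)%N]add0n ltn_add2r -has_count has_pred1.
have [/hasP[e eS me]|/hasPn unm] := boolP (has mk S).
  apply: (peel e eS) => H; apply: cut_relation_marked => //; first exact: hM.
  by rewrite mem_filter /= eqxx.
have [hT|/hasPn noT] := boolP (has (fun x => k.+2 < lv x)%N S).
  (* As labels are at most [M], this weight is lexicographic: highest level first, then smallest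
     label. *)
  have [e eS [Pe me]] := has_argmax (fun x => lv x * M.+1 + (M - lb x))%N hT.
  apply: (peel e eS) => H.
  have hS : {in S, forall x, (lv x <= lv e)%N && ((lv x == lv e) ==> (lb e <= lb x)%N)}.
    move=> x xS; have xM := hM _ xS; have eM := hM _ eS.
    have [hx|] := boolP (k.+2 < lv x)%N; last by move: Pe; lia.
    have := me _ xS hx; nia.
  have ins w : (w <= k.+1)%N -> cut_sum q M w (nseq (count_mem e S) e ++ filter (predC1 e) S) =
      qselect q true (count (follows^~ e) (filter (predC1 e) S)) (count_mem e S)
       * cut_sum q M w (filter (predC1 e) S).
    move=> wk; rewrite /cut_sum insert_top.
    - by rewrite (_ : follows _ e = false) //; move: Pe; letter_lia.
    - exact: unm.
    - move=> x; rewrite mem_filter => /andP[/= xe xS].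
      have := hS _ xS; have := unm _ xS; have := hM _ xS; have := unm _ eS; move: xe Pe.
      letter_lia.
    - by have := hM _ eS; move: Pe; letter_lia.
    - by move: Pe; letter_lia.
  by apply: cut_relation_scale (ins _ _) (ins _ _) H => //; rewrite ?(unm _ eS) //; move: Pe; lia.
have [hB|/hasPn noB] := boolP (has (fun x => lv x <= k)%N S).
  (* Lowest level first, then largest label. *)
  have [e eS [Pe me]] := has_argmax (fun x => (k - lv x) * M.+1 + lb x)%N hB.
  apply: (peel e eS) => H.
  have hS : {in S, forall x, (lv e <= lv x)%N && ((lv x == lv e) ==> (lb x <= lb e)%N)}.
    move=> x xS; have xM := hM _ xS; have eM := hM _ eS.
    have [hx|] := boolP (lv x <= k)%N; last by move: Pe; lia.
    have := me _ xS hx; nia.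
  have ins w : (k <= w)%N -> cut_sum q M w (nseq (count_mem e S) e ++ filter (predC1 e) S) =
      qselect q true (count (follows e) (filter (predC1 e) S)) (count_mem e S)
       * cut_sum q M w (filter (predC1 e) S).
    move=> wk; rewrite /cut_sum insert_bottom //.
    - exact: unm.
    - move=> x; rewrite mem_filter => /andP[/= xe xS].
      have := hS _ xS; have := unm _ xS; have := unm _ eS; move: xe Pe.
      letter_lia.
    - by move: Pe; letter_lia.
    - by move: Pe; letter_lia.
    - by rewrite implybT.
  by apply: cut_relation_scale (ins _ _) (ins _ _) H => //; rewrite ?(unm _ eS) //; move: Pe; lia.
apply: cut_relation_two_levels => // x xS.
have := noT _ xS; have := noB _ xS; rewrite (unm _ xS) (hM _ xS); lia.
Qed.

End AllLevels.

(** * Runs, lattice paths and their words *)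

Lemma runs_sorted z : all (fun r => (r != [::]) && sorted <=%O r) (runs z).
Proof.
elim: z => //= x z; case: (runs z) => [|[|y r] rs] //= H.
by case: ifP => /= [->|_]; rewrite H.
Qed.

Lemma flatten_runs z : flatten (runs z) = z.
Proof.
elim: z => //= x z; have := runs_sorted z; case: (runs z) => [|[|y r] rs] //= _ <- //.
by case: ifP.
Qed.

Lemma runs_flatten (d : mletter) (Rs : seq (seq mletter)) :
  all (fun r => (r != [::]) && sorted <=%O r) Rs ->
  sorted (fun r r' => (head d r' < last d r)%O) Rs ->
  runs (flatten Rs) = Rs.
Proof.
elim: Rs => //= r Rs IH /andP[/andP[rn sr] hRs] hp.
have {}IH : runs (flatten Rs) = Rs by apply: IH => //; apply: path_sorted hp.
have start : if Rs is (y :: _) :: _ then (y < last d r)%O else true.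
  by case: Rs hp {hRs IH} => [|[|y r'] Rs] //= /andP[].
elim: r rn sr start {hp} => // x [|y r] IHr _ sr start /=.
  rewrite IH; case: Rs start hRs {IH IHr} => [|[|y r'] Rs] //= yx _.
  by rewrite leNgt yx.
have {}IHr := IHr isT (path_sorted sr) start; rewrite /= in IHr.
rewrite IHr; by move: sr => /= /andP[-> _].
Qed.

Fixpoint levels (l : int) (p : seq bool) : seq int :=
  match p with
  | [::] => [::]
  | true :: p' => l :: levels (l + 1) p'
  | false :: p' => levels (l - 1) p'
  end.

Lemma level_cons b p k : level (b :: p) k.+1 = (if b then 1 else -1) + level p k.
Proof. by rewrite /level /=; case: b => /=; lia. Qed.

Lemma level0 p : level p 0 = 0.
Proof. by rewrite /level take0. Qed.

Lemma level_size p : level p (size p) = (count id p)%:Z - (count negb p)%:Z.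
Proof. by rewrite /level take_size. Qed.

Lemma area_wordE p : area_word p = levels 0 p.
Proof.
rewrite /area_word; under eq_map do rewrite -[level _ _]add0r.
elim: p (0 : int) => //= b p IHp l.
rewrite (iotaDl 1) filter_map.
have IHp' l' : [seq l' + level p k | k <- iota 0 (size p) & nth false p k] = levels l' p by [].
case: b => /=; rewrite ?level0 ?addr0 -map_comp.
  congr (_ :: _); rewrite -IHp'; apply: eq_map => k /=.
  by rewrite add1n level_cons addrA.
rewrite -IHp'; apply: eq_map => k /=; by rewrite add1n level_cons addrA.
Qed.

Definition climbs (a b : int) : bool := b <= a + 1.

Lemma climbs_path_start x y s : x <= y -> path climbs x s -> path climbs y s.
Proof. by case: s => //= a s xy /andP[h ->]; rewrite /climbs in h *; rewrite andbT; lia. Qed.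

(** The virtual predecessor [l - 1] bounds the first level by [l]. *)
Lemma levels_climb l p : path climbs (l - 1) (levels l p).
Proof.
elim: p l => //= -[] p IHp l /=.
  by rewrite /climbs subrK lexx /=; have := IHp (l + 1); rewrite addrK.
by apply: climbs_path_start (IHp _); lia.
Qed.

(** The last north step gains one level and at least one east step comes after it. *)
Lemma levels_last l p : ~~ last true p ->
  l + (count id p)%:Z - (count negb p)%:Z <= last (l - 1) (levels l p).
Proof.
elim: p l => // -[] p IHp l /= hl.
  have := IHp (l + 1) hl; rewrite addrK.
  by move: (count _ p) (count _ p) (last _ _) => a b c; lia.
case: p IHp hl => [|b p] IHp hl /=; first by lia.
have := IHp (l - 1) hl; rewrite /=.
have mono x y s : x <= y -> last x s <= last y s :> int by case: s.
have := mono (l - 1 - 1) (l - 1) (levels (l - 1) (b :: p)); rewrite /=; lia.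
Qed.

(** A path starts north exactly when its list starts with [l], since after an east step all lists
    start lower. The counts fix the final east steps, invisible in the list. *)
Lemma levels_inj l p p' : levels l p = levels l p' ->
  count id p = count id p' -> count negb p = count negb p' -> p = p'.
Proof.
have below x r : path climbs (x - 1) r -> ohead r != Some (x + 1).
  by case: r => //= a r /andP[h _]; apply/eqP => -[]; rewrite /climbs in h; lia.
elim: p l p' => [|b p IHp] l [|b' p'] //=; try by case: b'; lia.
  by case: b; lia.
case: b b' => -[] /= E; rewrite ?add0n ?add1n.
- by case: E => E [cT] cF; rewrite (IHp _ _ E).
- move=> _ _; have := levels_climb (l - 1) p'; rewrite -E => /below /=.
  by rewrite subrK eqxx.
- move=> _ _; have := levels_climb (l - 1) p; rewrite E => /below /=.
  by rewrite subrK eqxx.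
by move=> cT [cF]; rewrite (IHp _ _ E).
Qed.

(** A path below its final level must rise again, and its next north step starts no higher than the
    present point. *)
Lemma level_reached l p k : (k <= size p)%N -> level p k < level p (size p) ->
  exists2 a, a \in levels l p & a <= l + level p k.
Proof.
elim: p l k => [|b p IHp] l [|k] //=.
- move=> _; rewrite level0 level_cons addr0; case: b => h.
    by exists l; rewrite ?mem_head.
  have [||a ain ale] := IHp (l - 1) 0%N; rewrite ?level0 //; first by lia.
  by exists a => //; rewrite level0 in ale; lia.
- rewrite !level_cons => kp h; have [||a ain ale] := IHp (if b then l + 1 else l - 1) k => //.
    by case: b h; lia.
  exists a; first by case: b ain {h ale} => //=; rewrite in_cons orbC => ->.
  by case: b {h ain} ale; lia.
Qed.

(** Inverse of [levels] among paths ending on level 0. For a climbing list with nonnegative last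
    entry the absolute values are true differences. *)
Fixpoint path_of (l : int) (bs : seq int) : seq bool :=
  if bs is b :: bs' then nseq `|(l - b)%R| false ++ true :: path_of (b + 1) bs'
  else nseq `|l| false.

Lemma levels_nseq n l p : levels l (nseq n false ++ p) = levels (l - n%:Z) p.
Proof.
elim: n l => [|n IHn] l /=; first by rewrite subr0.
by rewrite IHn; congr levels; lia.
Qed.

Lemma levels_path_of l bs : path climbs (l - 1) bs -> levels l (path_of l bs) = bs.
Proof.
elim: bs l => [|b bs IHb] l /=.
  by rewrite -[nseq _ _]cats0 levels_nseq.
rewrite /climbs subrK => /andP[bl hb]; rewrite levels_nseq /=.
have -> : l - `|(l - b)%R|%N%:Z = b by lia.
by rewrite IHb // addrK.
Qed.

Lemma count_path_of l bs :
  count id (path_of l bs) = size bs.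
Proof.
elim: bs l => [|b bs IHb] l /=; first by rewrite count_nseq.
by rewrite count_cat count_nseq /= IHb.
Qed.

Lemma count_negb_path_of l bs : path climbs (l - 1) bs -> -1 <= last (l - 1) bs ->
  (count negb (path_of l bs))%:Z = l + (size bs)%:Z.
Proof.
elim: bs l => [|b bs IHb] l /=; first by rewrite count_nseq; lia.
rewrite /climbs subrK => /andP[bl hb] hl; rewrite count_cat count_nseq /= add0n mul1n.
have := IHb (b + 1); rewrite addrK => /(_ hb hl); lia.
Qed.

Lemma last_path_of x l bs : 0 <= last (l - 1) bs -> ~~ last x (path_of l bs).
Proof.
elim: bs l x => [|b bs IHb] l x /=.
  by move=> hl; case E: `|l|%N => [|n] /=; [lia | elim: n {E}].
by move=> hl; rewrite last_cat /= IHb // addrK.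
Qed.

(** * The word of a decorated path *)

Definition path_word (N : nat) (p : seq bool) (w : seq nat) (dv : {set 'I_N}) : seq letter :=
  [seq ((`|(aw p j + (shift p)%:Z)%R|%N.+1, lab w j), j \in dv) : letter
  | j : 'I_N <- enum 'I_N].

Section PathWord.

Variables (N : nat) (p : seq bool).

Hypothesis sq_p : square_path N p.

Lemma sq_size_area : size (area_word p) = N.
Proof. by rewrite size_area_word; case/and3P: sq_p => /eqP. Qed.

Lemma sq_climbs : path climbs (- 1) (area_word p).
Proof. by rewrite area_wordE; have := levels_climb 0 p; rewrite sub0r. Qed.

Lemma sq_last : 0 <= last (- 1) (area_word p).
Proof.
have /and3P[/eqP cT /eqP cF lp] := sq_p.
by have := levels_last 0 lp; rewrite area_wordE cT cF sub0r add0r subrr.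
Qed.

Lemma sq_pos : (0 < N)%N.
Proof. by have := sq_last; rewrite -sq_size_area; case: (area_word p). Qed.

Lemma sq_level_end : level p (size p) = 0.
Proof. by have /and3P[/eqP cT /eqP cF _] := sq_p; rewrite level_size cT cF subrr. Qed.

(** The path returns to level 0, so by [level_reached] its lowest line is already met at the start
    of a north step. *)
Lemma sq_shift (s : nat) :
  {in area_word p, forall a, - (s%:Z) <= a} -> - (s%:Z) \in area_word p -> shift p = s.
Proof.
move=> ges ins; apply/eqP; rewrite eqn_leq; apply/andP; split.
  apply/bigmax_leqP => s' /existsP[k /eqP lk].
  case: (posnP s') => [->//|s'0].
  have kp : (k <= size p)%N by rewrite -ltnS.
  have [|a ain ale] := @level_reached 0 p k kp.
    by rewrite sq_level_end lk; lia.
  by rewrite -area_wordE in ain; have := ges _ ain; rewrite add0r lk in ale; lia.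
move: ins => /mapP[k]; rewrite mem_filter mem_iota => /andP[_ /andP[_ kp]] lk.
by have := shift_ge (ltnW kp); rewrite -lk; lia.
Qed.

Lemma sq_aw_rise (j : nat) : (j.+1 < N)%N -> aw p j.+1 <= aw p j + 1.
Proof.
move=> jN; have /(pathP 0)/(_ j.+1) := sq_climbs.
by rewrite sq_size_area => /(_ jN).
Qed.

Lemma sq_aw_head : aw p 0 <= 0.
Proof.
have /(pathP 0)/(_ 0%N) := sq_climbs; rewrite sq_size_area => /(_ sq_pos) /=.
by rewrite /climbs addNr.
Qed.

Lemma sq_aw_last : 0 <= aw p N.-1.
Proof.
have := sq_last; have := sq_pos; rewrite /aw -sq_size_area.
by case: (area_word p) => //= a r _; rewrite (last_nth 0).
Qed.

Variables (w : seq nat) (dv : {set 'I_N}).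

Local Notation W := (path_word p w dv).

Lemma size_path_word : size W = N.
Proof. by rewrite size_map size_enum_ord. Qed.

Lemma nth_path_word x0 (j : 'I_N) :
  nth x0 W j = ((`|(aw p j + (shift p)%:Z)%R|%N.+1, lab w j), j \in dv).
Proof. by rewrite (nth_map j) ?size_enum_ord // nth_ord_enum. Qed.

Lemma path_word_step x0 (j : 'I_N) :
  follows (nth x0 (start_letter (shift p) :: W) j) (nth x0 W j) =
    (if j == 0%N :> nat then (aw p 0 == 0) ==> (0 < lab w 0)%N
     else (aw p j.-1 < aw p j) ==> (lab w j.-1 < lab w j)%N)
    && ((j \in dv) ==> contractible p w j).
Proof.
rewrite nth_path_word; have aj := aw_ge j sq_p; rewrite /contractible.
case: j aj => -[|j] jN aj /=.
  have := sq_aw_head; move: aj; rewrite /follows /lv /lb /mk /=.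
  case: (_ \in dv) => /=; lia.
have jN' := ltnW jN; rewrite (nth_path_word x0 (Ordinal jN')) /=.
have := aw_ge (Ordinal jN') sq_p; have := sq_aw_rise jN.
move: aj; rewrite /follows /lv /lb /mk /=.
case: (_ \in dv) => /=; lia.
Qed.

Lemma path_word_path M : all (fun c => c <= M)%N w -> size w = N ->
  path follows (start_letter (shift p)) (rcons W (end_letter M (shift p))) =
    [forall j : 'I_N, (if j == 0%N :> nat then (aw p 0 == 0) ==> (0 < lab w 0)%N
     else (aw p j.-1 < aw p j) ==> (lab w j.-1 < lab w j)%N)
    && ((j \in dv) ==> contractible p w j)].
Proof.
move=> wM sw; rewrite rcons_path.
have -> : follows (last (start_letter (shift p)) W) (end_letter M (shift p)).
  rewrite -nth_last size_path_word; have Np := sq_pos.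
  have jN : (N.-1 < N)%N by rewrite prednK.
  rewrite (nth_path_word _ (Ordinal jN)) /=.
  have := sq_aw_last; have : (lab w N.-1 <= M)%N by apply: (allP wM); rewrite mem_nth ?sw.
  by rewrite /follows /lv /lb /mk /=; lia.
rewrite andbT; apply/(pathP (0%N, 0%N, false))/forallP => [h j|h j jN].
  by rewrite -(path_word_step (0%N, 0%N, false)) h // size_path_word.
by rewrite size_path_word in jN; rewrite (path_word_step _ (Ordinal jN)) h.
Qed.

End PathWord.

Lemma pair_stat_nth (T : eqType) (f : T -> T -> nat) (x0 : T) (s : seq T) :
  pair_stat f s = (\sum_(0 <= i < size s) \sum_(0 <= j < size s | (i < j)%N)
                     f (nth x0 s i) (nth x0 s j))%N.
Proof.
elim: s => [|x s IHs] /=; first by rewrite big_geq.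
rewrite big_nat_recl // IHs; congr (_ + _)%N.
  by rewrite [RHS]big_mkcond big_nat_recl //= add0n [LHS](big_nth x0).
by apply: eq_bigr => i _; rewrite [RHS]big_mkcond big_nat_recl //= add0n -big_mkcond.
Qed.

Section PathStatistics.

Variables (N : nat) (p : seq bool) (w : seq nat) (dv : {set 'I_N}).

Hypothesis sq_p : square_path N p.
Local Notation W := (path_word p w dv).

Lemma dinv_path_word : dinv p w dv =
  (pair_stat inv_stat W)%:Z
  + (count (fun x => (lv x <= shift p)%N && (0 < lb x)%N) W)%:Z - (count mk W)%:Z.
Proof.
rewrite /dinv; congr (_%:Z + _%:Z - _%:Z); last 2 first.
- rewrite cardsE cardE size_filter count_map -enumT; apply: eq_count => j /=.
  have := aw_ge j sq_p; rewrite /lv /lb /= -topredE /=; lia.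
- by rewrite cardE size_filter count_map -enumT; apply: eq_count => j.
rewrite (pair_stat_nth _ (0%N, 0%N, false)) size_path_word big_mkord.
transitivity (\sum_(i < N) \sum_(j < N) (inversion p w i j && (i \notin dv)))%N.
  rewrite pair_bigA /= -sum1_card big_mkcond; apply: eq_bigr => -[i j] _.
  by rewrite inE /=; case: (_ && _).
apply: eq_bigr => i _; rewrite big_mkord [RHS]big_mkcond; apply: eq_bigr => j _.
rewrite !nth_path_word /inversion /inv_stat /inverts /lv /lb /mk /=.
have := aw_ge i sq_p; have := aw_ge j sq_p.
by case: (i \in dv) => /=; case: (ltnP i j) => //=; lia.
Qed.

Lemma area_path_word : area N p = \sum_(x <- W) ((lv x).-1)%:Z.
Proof.
rewrite /area big_map big_enum /=; apply: eq_bigr => j _.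
by have := aw_ge j sq_p; rewrite /lv /=; lia.
Qed.

Hypothesis sw : size w = N.

Lemma map_lb_path_word : map lb W = w.
Proof.
apply: (@eq_from_nth _ 0%N); rewrite size_map size_path_word // => j jN.
by rewrite (nth_map (0%N, 0%N, false)) ?size_path_word // (nth_path_word _ _ _ _ (Ordinal jN)).
Qed.

Lemma xpath_path_word : xpath w = \prod_(x <- W) xv (lb x).
Proof. by rewrite /xpath -{1}map_lb_path_word big_map. Qed.

End PathStatistics.

Lemma path_word_inj N p p' w w' (dv dv' : {set 'I_N}) :
  square_path N p -> square_path N p' -> size w = N -> size w' = N ->
  shift p = shift p' -> path_word p w dv = path_word p' w' dv' ->
  [/\ p = p', w = w' & dv = dv'].
Proof.
move=> sp sp' sw sw' es E.
have nthE (j : 'I_N) : ((`|(aw p j + (shift p)%:Z)%R|%N.+1, lab w j), j \in dv)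
    = ((`|(aw p' j + (shift p')%:Z)%R|%N.+1, lab w' j), j \in dv').
  by rewrite -!(nth_path_word _ _ _ (0%N, 0%N, false)) E.
split; last 1 first.
- by apply/setP => j; case: (nthE j).
- have Ea : area_word p = area_word p'.
    apply: (@eq_from_nth _ 0); rewrite (sq_size_area sp) ?(sq_size_area sp') // => j jN.
    have [/= h _ _] := nthE (Ordinal jN).
    have := aw_ge (Ordinal jN) sp; have := aw_ge (Ordinal jN) sp'.
    by rewrite /= -es in h *; rewrite -/(aw p j) -/(aw p' j); lia.
  move: sp sp' => /and3P[/eqP c1 /eqP c2 _] /and3P[/eqP c3 /eqP c4 _].
  by apply: (@levels_inj 0); rewrite -?area_wordE ?c1 ?c2.
by rewrite -(map_lb_path_word p dv sw) E map_lb_path_word.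
Qed.

(** * Diagonal words and their letters *)

Definition layer (i : nat) (S : seq letter) : seq mletter :=
  [seq ((lb x, mk x) : mletter) | x <- S & lv x == i.+1].

(** The multiset of north steps prescribed by [z]. It does not involve the shift, so both generating
    functions arrange the same letters. *)
Definition run_letters (z : seq mletter) : seq letter :=
  flatten [seq [seq ((i.+1, x.1), x.2) : letter | x : mletter <- rho z i]
          | i <- iota 0 (size (runs z))].

Lemma rho_default z i : (size (runs z) <= i)%N -> rho z i = [::].
Proof. by move=> h; rewrite /rho nth_default ?size_rev. Qed.

Lemma layer_run_letters z i : layer i (run_letters z) = rho z i.
Proof.
rewrite /layer /run_letters filter_flatten map_flatten -!map_comp.
have -> : [seq ([eta map (fun x => (lb x, mk x) : mletter)] \o filter (fun x => lv x == i.+1)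
     \o (fun k => [seq ((k.+1, x.1), x.2) : letter | x : mletter <- rho z k])) k
     | k <- iota 0 (size (runs z))] =
   [seq (if k == i then rho z k else [::]) | k <- iota 0 (size (runs z))].
  apply: eq_map => k /=; rewrite filter_map -map_comp /=.
  rewrite (@eq_filter _ _ (fun=> k == i)) => [|x]; last by rewrite /lv /= eqSS.
  case: (k == i); last by rewrite filter_pred0.
  by rewrite filter_predT -[RHS]map_id; apply: eq_map => -[].
case: (ltnP i (size (runs z))) => [ir|ri]; last first.
  rewrite (rho_default ri); elim: iota => //= k ks ->.
  by case: eqP => // ->; rewrite (rho_default ri).
rewrite -(subnKC ir) -addn1 -addnA iotaD map_cat flatten_cat.
have E0 m n : (i \notin iota m n) ->
    flatten [seq (if k == i then rho z k else [::]) | k <- iota m n] = [::].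
  elim: n m => //= n IHn m; rewrite in_cons negb_or eq_sym => /andP[/negbTE -> /IHn ->].
  by [].
rewrite E0 ?mem_iota ?ltnn //= add0n eqxx E0 ?cats0 // mem_iota; lia.
Qed.

Lemma run_letters_lv z x : x \in run_letters z -> (0 < lv x <= size (runs z))%N.
Proof.
by case/flattenP => s /mapP[i]; rewrite mem_iota => /andP[_ h] -> /mapP[y _ ->].
Qed.

Lemma perm_layers (S S' : seq letter) :
  {in S, forall x, 0 < lv x}%N -> {in S', forall x, 0 < lv x}%N ->
  (forall i, perm_eq (layer i S) (layer i S')) -> perm_eq S S'.
Proof.
move=> hS hS' h; apply/allP => -[[a c] b] _ /=; apply/eqP.
have E U i : count_mem ((i.+1, c, b) : letter) U = count_mem ((c, b) : mletter) (layer i U).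
  rewrite count_map count_filter; apply: eq_count => -[[a' c'] b'] /=.
  by rewrite letter_eqE /lv /lb /mk /= -pair_eqE /pair_eq /= andbC.
case: a => [|i]; last by rewrite !E (permP (h i)).
by rewrite !(count_memPn _) //; apply/negP; first [by move/hS | by move/hS'].
Qed.

Lemma perm_layer i S S' : perm_eq S S' -> perm_eq (layer i S) (layer i S').
Proof. by move=> h; apply/perm_map/perm_filter. Qed.

Lemma last_gt_head (d : mletter) (r r' : seq mletter) x y :
  sorted <=%O r -> sorted <=%O r' -> x \in r -> y \in r' -> (y < x)%O ->
  (head d r' < last d r)%O.
Proof.
move=> sr sr' xr yr' yx.
have h1 : (head d r' <= y)%O.
  case: r' sr' yr' => //= a r' h; rewrite in_cons => /predU1P[-> //|].
  by apply/allP; apply: order_path_min h; apply: le_trans.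
apply: le_lt_trans h1 (lt_le_trans yx _).
elim: r sr xr {sr'} => //= a r IHr h; rewrite in_cons => /predU1P[->|xr].
  case: r h {IHr} => [|b r] h //=; have /allP := order_path_min (@le_trans _ _) h.
  by apply; apply: mem_last.
by case: r IHr h xr => //= b r IHr /andP[_ h] xr; apply: IHr.
Qed.

Section DiagonalWord.

Variables (N : nat) (p : seq bool) (w : seq nat) (dv : {set 'I_N}).

Hypothesis sq_p : square_path N p.

Local Notation W := (path_word p w dv).
Local Notation top := (top_diag N p).

Lemma diag_word_layer i : diag_word p w dv i = sort <=%O (layer i W).
Proof.
rewrite /diag_word /layer /path_word filter_map -map_comp; congr sort.
congr map; apply: eq_filter => j /=; have := aw_ge j sq_p; rewrite /lv /=; lia.
Qed.

Lemma lv_path_word_le x : x \in W -> (lv x <= top.+1)%N.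
Proof.
case/mapP => j _ ->; rewrite /lv /= ltnS.
exact: (@leq_bigmax_cond _ _ (fun j : 'I_N => `|(aw p j + (shift p)%:Z)%R|%N)).
Qed.

Lemma top_reached : exists j : 'I_N, aw p j + (shift p)%:Z = top%:Z.
Proof.
have N0 := sq_pos sq_p.
have [|j _ hj] := @eq_bigmax_cond _ predT (fun j : 'I_N => `|(aw p j + (shift p)%:Z)%R|%N).
  by rewrite card_ord.
by exists j; rewrite /top_diag hj; have := aw_ge j sq_p; lia.
Qed.

Lemma crossing (m n : nat) (c : int) : (m <= n)%N -> aw p m <= c -> c < aw p n ->
  exists2 j, (m <= j < n)%N & aw p j <= c < aw p j.+1.
Proof.
move=> mn hm; elim: n mn => [|n IHn] mn hn.
  by move: mn hm; rewrite leqn0 => /eqP -> hm; lia.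
case: (lerP (aw p n) c) => [h|h].
  exists n; last by rewrite h.
  rewrite ltnSn andbT; move: mn; rewrite leq_eqVlt => /predU1P[E|//].
  by move: hm hn; rewrite E; lia.
have [|j hj h'] := IHn _ h.
  by move: mn; rewrite leq_eqVlt => /predU1P[E|//]; move: hm hn; rewrite E; lia.
by exists j => //; lia.
Qed.

(* Below the main diagonal the path rises after its lowest point, towards its end;
   above it, the path rises from its start towards its highest point.  This is why
   the diagonals are separated by descents in the diagonal word. *)
Lemma diagonal_rise i : - (shift p)%:Z \in area_word p -> (i < top)%N ->
  exists2 j, (j.+1 < N)%N & aw p j + (shift p)%:Z = i%:Z /\ aw p j.+1 + (shift p)%:Z = i.+1%:Z.
Proof.
move=> hs it; have N0 := sq_pos sq_p.
have [m [n [mn nN hm hn]]] : exists m n, [/\ (m <= n)%N, (n < N)%N,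
    aw p m <= i%:Z - (shift p)%:Z & i%:Z - (shift p)%:Z < aw p n].
  case: (leqP (shift p) i) => h.
    have [j hj] := top_reached; exists 0%N, j; split=> //; last by lia.
    by have := sq_aw_head sq_p; lia.
  case/(nthP 0): hs => j; rewrite (sq_size_area sq_p) => jN hj.
  exists j, N.-1; split; try lia; first by rewrite /aw hj; lia.
  by have := sq_aw_last sq_p; lia.
have [j hj h] := crossing mn hm hn; exists j; first by lia.
have jN : (j.+1 < N)%N by lia.
by have := sq_aw_rise sq_p jN; lia.
Qed.

(** At a rise between consecutive north steps from diagonal [i] to [i.+1] the label increases
    strictly, which forces a descent between the two sorted words; hence the runs are the
    diagonals. *)
Lemma rho_dw z : vd_square_path p w dv -> dw p w dv = z ->
  forall i, rho z i = diag_word p w dv i.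
Proof.
case/and3P => _ /and4P[/eqP sw /forallP hrise _ /existsP[j0 /andP[/eqP hj0 _]]] _ <-.
have hs : - (shift p)%:Z \in area_word p.
  by rewrite -hj0; apply: mem_nth; rewrite (sq_size_area sq_p).
pose d : mletter := (0%N, false).
have memD (j : 'I_N) i : aw p j + (shift p)%:Z = i%:Z ->
    ((lab w j, j \in dv) : mletter) \in diag_word p w dv i.
  move=> h; rewrite mem_sort; apply/mapP; exists j => //.
  by rewrite mem_filter h eqxx mem_enum.
have runsE : runs (dw p w dv) = [seq diag_word p w dv i | i <- rev (iota 0 top.+1)].
  apply: (runs_flatten (d := d)).
    apply/allP => r /mapP[i]; rewrite mem_rev mem_iota add0n ltnS => /andP[_ it] ->.
    apply/andP; split; last by apply: sort_le_sorted.
    have [j hj] : exists j : 'I_N, aw p j + (shift p)%:Z = i%:Z.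
      move: it; rewrite leq_eqVlt => /predU1P[->|it]; first exact: top_reached.
      by have [j jN [hj _]] := diagonal_rise hs it; exists (Ordinal (ltnW jN)).
    by have := memD _ _ hj; case: (diag_word _ _ _ _).
  rewrite map_rev rev_sorted sorted_map; apply/(sortedP 0%N) => i; rewrite size_iota => it.
  rewrite !nth_iota // 1?ltnW // !add0n /=.
  have [j jN [h1 h2]] := diagonal_rise hs it.
  apply: (@last_gt_head d _ _ (lab w j.+1, Ordinal jN \in dv)
    (lab w j, Ordinal (ltnW jN) \in dv)); rewrite ?sort_le_sorted //.
  - exact: (memD (Ordinal jN)).
  - exact: (memD (Ordinal (ltnW jN))).
  have lt_lab : (lab w j < lab w j.+1)%N.
    by apply: (implyP (hrise (Ordinal jN))); rewrite /=; lia.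
  by rewrite ltxi_pair !leEnat (ltnW lt_lab) (leqNgt (lab w j.+1)) lt_lab.
move=> i; rewrite /rho runsE map_rev revK; case: (ltnP i top.+1) => it.
  by rewrite (nth_map 0%N) ?size_iota // nth_iota.
rewrite nth_default ?size_map ?size_iota //; apply/esym/size0nil.
rewrite diag_word_layer size_sort size_map size_filter; apply/eqP.
rewrite -leqn0 leqNgt -has_count.
by apply/hasPn => x /lv_path_word_le h; apply/eqP; lia.
Qed.

Lemma perm_path_word z : vd_square_path p w dv -> dw p w dv = z ->
  perm_eq W (run_letters z).
Proof.
move=> hv hz; apply: perm_layers => [x /mapP[j _ ->] //|x /run_letters_lv/andP[] //|i].
by rewrite layer_run_letters (rho_dw hv hz) diag_word_layer perm_sym perm_sort.
Qed.

End DiagonalWord.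

Lemma dw_run_letters N p w (dv : {set 'I_N}) z : square_path N p ->
  perm_eq (path_word p w dv) (run_letters z) -> dw p w dv = z.
Proof.
move=> sq_p hp.
have DE i : diag_word p w dv i = rho z i.
  have sr : sorted <=%O (rho z i).
    rewrite /rho; case: (ltnP i (size (runs z))) => [ir|ri]; last first.
      by rewrite nth_default ?size_rev.
    have : nth [::] (rev (runs z)) i \in runs z by rewrite -mem_rev mem_nth // size_rev.
    by move/(allP (runs_sorted z))/andP => [].
  rewrite diag_word_layer // -(sort_le_id sr); apply/perm_sort_leP.
  by rewrite -(layer_run_letters z); apply: perm_layer.
have topE : (top_diag N p).+1 = size (runs z).
  apply/eqP; rewrite eqn_leq; apply/andP; split.
    have [j hj] := top_reached sq_p.
    have : nth (0%N, 0%N, false) (path_word p w dv) j \in run_letters z.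
      by rewrite -(perm_mem hp) mem_nth // size_path_word.
    move/run_letters_lv; rewrite nth_path_word hj /lv /=; lia.
  case E: (size (runs z)) => [|n] //.
  have : rho z n != [::].
    have : rho z n \in runs z by rewrite /rho -mem_rev mem_nth // size_rev E.
    by move/(allP (runs_sorted z))/andP => [].
  rewrite -layer_run_letters; case L: (layer n (run_letters z)) => [//|y s] _.
  have : y \in layer n (run_letters z) by rewrite L mem_head.
  case/mapP => x; rewrite mem_filter => /andP[/eqP lx xr] _.
  by rewrite -lx; apply: (@lv_path_word_le _ _ w dv); rewrite (perm_mem hp).
rewrite /dw topE; under eq_map do rewrite DE.
rewrite map_rev -[RHS]flatten_runs; congr flatten.
apply: (@eq_from_nth _ [::]); rewrite size_rev size_map size_iota // => i ir.
rewrite nth_rev ?size_map ?size_iota // (nth_map 0%N) ?size_iota; last by lia.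
rewrite nth_iota; last by lia.
by rewrite add0n /rho nth_rev; [congr nth; lia | lia].
Qed.

Lemma perm_run_letters z :
  perm_eq [seq ((lb x, mk x) : mletter) | x <- run_letters z] z.
Proof.
rewrite /run_letters map_flatten -map_comp -[X in perm_eq _ X]flatten_runs.
rewrite (_ : map _ _ = rev (runs z)); first by apply: perm_flatten; rewrite perm_rev.
rewrite -[RHS](mkseq_nth [::]) size_rev /mkseq; apply: eq_map => i /=.
by rewrite -map_comp -[RHS]map_id; apply: eq_map => -[].
Qed.

Lemma size_run_letters z : size (run_letters z) = size z.
Proof. by rewrite -(perm_size (perm_run_letters z)) size_map. Qed.

Lemma lb_run_letters z x : x \in run_letters z -> (lb x <= max_letter z)%N.
Proof.
move=> xr; have : (lb x, mk x) \in z.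
  by rewrite -(perm_mem (perm_run_letters z)); apply/mapP; exists x.
by move=> xz; apply: (leq_bigmax_seq (P := predT) (F := fun x : mletter => x.1) _ xz isT).
Qed.

(* The lowest diagonal carries a positive label, as required of a partial
   labelling; for an anchored word the shift is determined by the cut. *)
Definition anchored (S : seq letter) : bool := has (fun x => (lv x == 1%N) && (0 < lb x)%N) S.

Lemma path_word_anchored N p w (dv : {set 'I_N}) :
  vd_square_path p w dv -> anchored (path_word p w dv).
Proof.
case/and3P => _ /and4P[_ _ _ /existsP[j /andP[/eqP h hl]]] _.
apply/hasP; exists ((`|(aw p j + (shift p)%:Z)%R|%N.+1, lab w j), j \in dv).
  by apply/mapP; exists j; rewrite ?mem_enum.
by rewrite h addNr /lv /lb /= hl.
Qed.

(** Surjectivity of the encoding. The virtual end letters give a first level at most 0 and a last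
    one at least 0, which makes the decoded path square; anchoring makes [s] its shift. *)
Lemma word_path z s W : perm_eq W (run_letters z) -> anchored W ->
  path follows (start_letter s) (rcons W (end_letter (max_letter z) s)) ->
  exists p (dv : {set 'I_(size z)}), [/\ vd_square_path p (map lb W) dv,
    shift p = s, dw p (map lb W) dv = z & path_word p (map lb W) dv = W].
Proof.
move=> hp anc hpath; have sW : size W = size z by rewrite (perm_size hp) size_run_letters.
have Wlv x : x \in W -> (0 < lv x)%N by rewrite (perm_mem hp) => /run_letters_lv/andP[].
pose g (x : letter) : int := (lv x)%:Z - 1 - s%:Z.
pose d : letter := (0%N, 0%N, false).
have g0 : g (start_letter s) = 0 - 1 by rewrite /g /start_letter /lv /=; lia.
have [hW hend] : path follows (start_letter s) W /\
    follows (last (start_letter s) W) (end_letter (max_letter z) s).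
  by move: hpath; rewrite rcons_path => /andP.
have hclimb : path climbs (0 - 1) (map g W).
  rewrite -g0 path_map; apply: sub_path hW => u v /and3P[+ _ _] /=.
  by rewrite /climbs /g; lia.
have hlast : 0 <= last (0 - 1) (map g W).
  by rewrite -g0 last_map /g; case/and3P: hend => + _ _; rewrite {1}/lv /=; lia.
pose p := path_of 0 (map g W).
have sq_p : square_path (size z) p.
  rewrite /square_path count_path_of size_map sW eqxx /=.
  rewrite last_path_of // andbT -eqz_nat count_negb_path_of ?size_map ?sW ?add0r //.
  by apply: le_trans hlast.
have ap : area_word p = map g W by rewrite area_wordE levels_path_of.
have awE j : (j < size z)%N -> aw p j = g (nth d W j).
  by move=> jz; rewrite /aw ap (nth_map d) // sW.
have sp : shift p = s.
  apply: (sq_shift sq_p); rewrite ap.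
    by move=> a /mapP[x /Wlv x0 ->]; rewrite /g; lia.
  case/hasP: anc => x xW /andP[/eqP x1 _]; apply/mapP; exists x => //.
  by rewrite /g x1; lia.
pose dv := [set j : 'I_(size z) | mk (nth d W j)].
have pw : path_word p (map lb W) dv = W.
  apply: (@eq_from_nth _ d); rewrite ?size_path_word // => j jz.
  rewrite (nth_path_word _ _ _ _ (Ordinal jz)) /= awE // sp inE /= /lab (nth_map d) ?sW //.
  have := Wlv _ (mem_nth d (etrans (congr1 (leq j.+1) sW) jz)); rewrite /g.
  case: (nth d W j) => [[a b] m]; rewrite /lv /lb /mk /= => a0.
  by congr (_, _, _); lia.
exists p, dv; split => //; last by apply: dw_run_letters; rewrite ?pw.
have sw : size (map lb W) = size z by rewrite size_map.
have lbW : all (fun c => c <= max_letter z)%N (map lb W).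
  by apply/allP => c /mapP[x xW ->]; apply: lb_run_letters; rewrite -(perm_mem hp).
have := path_word_path sq_p dv lbW sw; rewrite pw sp hpath => /esym/forallP hj.
rewrite /vd_square_path sq_p /partial_labelling sw eqxx /=; apply/andP; split; last first.
  by apply/forall_inP => j jdv; case/andP: (hj j) => _; rewrite jdv.
apply/and3P; split.
- apply/forallP => j; apply/implyP => /andP[j0 rise].
  by case/andP: (hj j); rewrite (gtn_eqF j0) rise.
- by case/andP: (hj (Ordinal (sq_pos sq_p))).
case/hasP: anc => x xW /andP[/eqP x1 xl].
have xz : (index x W < size z)%N by rewrite -sW index_mem.
apply/existsP; exists (Ordinal xz); rewrite /= awE // /lab (nth_map d) ?sW // nth_index //.
by rewrite xl sp /g x1 andbT; apply/eqP; lia.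
Qed.

Lemma perm_anchored S S' : perm_eq S S' -> anchored S = anchored S'.
Proof. by move=> h; apply/eq_has_r => x; exact: perm_mem. Qed.

(** * The generating function *)

Lemma qv_neq0 : qv != 0.
Proof. by rewrite /qv tofrac_eq0 polyC_eq0 polyX_eq0. Qed.

Lemma qv_nonroot n : qv ^+ n.+1 != 1.
Proof.
rewrite /qv -tofracXn -tofrac1 tofrac_eq -rmorphXn -polyC1 (inj_eq polyC_inj).
by apply/eqP => /(congr1 (fun r : {poly rat} => size r)); rewrite size_polyXn size_poly1.
Qed.

Lemma geometric_qbrz (K : fieldType) (q : K) (n : int) : q != 0 ->
  (1 - q) * (match n with
             | Posz m => \sum_(k < m) q ^+ k
             | Negz m => - \sum_(k < m.+1) q ^- k.+1
             end) = qbrz q n.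
Proof.
move=> q0; have geo m : (1 - q) * \sum_(k < m) q ^+ k = 1 - q ^+ m.
  by rewrite -opprB mulNr -subrX1 opprB.
rewrite /qbrz; case: n => m; first exact: geo.
rewrite NegzE -exprnN.
rewrite (_ : \sum_(k < _) _ = q ^- m.+1 * \sum_(k < m.+1) q ^+ k); last first.
  rewrite mulr_sumr (reindex_inj rev_ord_inj) /=; apply: eq_bigr => k _.
  have -> : q ^+ m.+1 = q ^+ (m.+1 - k.+1).+1 * q ^+ k.
    by rewrite -exprD; congr (_ ^+ _); have := ltn_ord k; lia.
  by rewrite invfM -mulrA mulVf ?mulr1 // expf_neq0.
by rewrite mulrN mulrCA geo mulrBr mulr1 mulVf ?opprB // expf_neq0.
Qed.

Lemma qint_qbrz n : (1 - qv) * qint n = qbrz qv n.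
Proof. exact: geometric_qbrz qv_neq0. Qed.

Lemma exprz_shift (K : fieldType) (q t : K) (a : nat) (b : int) : q != 0 ->
  q ^ (a%:Z + b) * t = q ^ b * t * q ^+ a.
Proof. by move=> q0; rewrite expfzDr // -mulrA mulrC. Qed.

Lemma sum_scaled (K : fieldType) (V : lmodType K) (I : finType) (P : pred I)
    (c : K) (F : I -> K) (X : V) :
  \sum_(i | P i) (c * F i) *: X = (c * \sum_(i | P i) F i) *: X.
Proof. by rewrite mulr_sumr scaler_suml. Qed.

(** The bonus term of [dinv]: [lv x <= s] means a negative entry of the area word. *)
Definition negative_letters (s : nat) (S : seq letter) : nat :=
  count (fun x => (lv x <= s)%N && (0 < lb x)%N) S.

Definition total_level (S : seq letter) : int := \sum_(x <- S) ((lv x).-1)%:Z.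

Definition path_data (z : seq mletter) : finType :=
  (((size z + size z).-tuple bool * (size z).-tuple 'I_(max_letter z).+1)
   * {set 'I_(size z)})%type.

Definition counted (z : seq mletter) (s : nat) (i : path_data z) : bool :=
  [&& vd_square_path i.1.1 (map val i.1.2) i.2, shift i.1.1 == s
    & dw i.1.1 (map val i.1.2) i.2 == z].

Definition data_word (z : seq mletter) (i : path_data z) : seq letter :=
  path_word i.1.1 (map val i.1.2) i.2.

Lemma size_labels (z : seq mletter) (w : (size z).-tuple 'I_(max_letter z).+1) :
  size (map val w) = size z.
Proof. by rewrite size_map size_tuple. Qed.

(** The encoding is a bijection: [path_word_inj] applies because the shift is fixed, and [word_path]
    reaches every word. *)
Lemma perm_data_words z s : anchored (run_letters z) ->
  perm_eq [seq data_word i | i <- enum (path_data z) & counted s i]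
   [seq W <- permutations (run_letters z)
       | path follows (start_letter s) (rcons W (end_letter (max_letter z) s))].
Proof.
move=> anc; set T := run_letters z in anc *; set M := max_letter z.
apply: uniq_perm.
- rewrite map_inj_in_uniq ?filter_uniq -?enumT ?enum_uniq //.
    move=> [[p w] dv] [[p' w'] dv']; rewrite !mem_filter => /andP[/and3P[/= hv /eqP sp _] _].
    move=> /andP[/and3P[/= hv' /eqP sp' _] _] E.
    have sq_p : square_path (size z) p by case/and3P: hv.
    have sq_p' : square_path (size z) p' by case/and3P: hv'.
    have [e1 e2 e3] := path_word_inj sq_p sq_p' (size_labels w) (size_labels w')
      (etrans sp (esym sp')) E.
    by congr (_, _, _) => //; apply: val_inj => //; apply: (inj_map val_inj).
- exact/filter_uniq/permutations_uniq.
  move=> W; rewrite mem_filter mem_permutations; apply/mapP/andP.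
    case=> -[[p w] dv]; rewrite mem_filter => /andP[/and3P[/= hv /eqP sp /eqP hz] _] ->.
    have sq_p : square_path (size z) p by case/and3P: hv.
    split; last exact: perm_path_word.
    have wM : all (fun c => c <= M)%N (map val w).
      by apply/allP => _ /mapP[j _ ->]; rewrite -ltnS ltn_ord.
    rewrite /data_word /= -sp path_word_path ?size_labels //.
    case/and3P: hv => _ /and4P[_ /forallP h1 h2 _] /forall_inP h3; apply/forallP => j.
    apply/andP; split; last by apply/implyP => /h3.
    case: eqP => [//|/eqP j0]; apply/implyP => h; apply: (implyP (h1 j)).
    by rewrite lt0n j0.
  case=> hpath hp; rewrite (perm_anchored (S' := W)) 1?perm_sym // in anc.
  have [p [dv [hv sp hz hW]]] := word_path hp anc hpath.
  have sW : size (map lb W) = size z.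
    by rewrite size_map (perm_size hp) size_run_letters.
  have sz : size p == (size z + size z)%N.
    case/and3P: hv => /and3P[/eqP cT /eqP cF _] _ _.
    by rewrite -(count_predC id p) cT cF.
  pose w0 := map (fun x => inord (lb x) : 'I_M.+1) W.
  have sw0 : size w0 == size z by rewrite size_map (perm_size hp) size_run_letters.
  have ew0 : map val w0 = map lb W.
    rewrite -map_comp; apply/eq_in_map => x xW /=; rewrite inordK // ltnS.
    by apply: lb_run_letters; rewrite -(perm_mem hp).
  exists ((Tuple sz, Tuple sw0), dv); last by rewrite /data_word /= ew0.
  by rewrite mem_filter mem_enum andbT /counted /= ew0 hv sp hz !eqxx.
Qed.

Lemma sum_data_words (K : fieldType) (q : K) z s : anchored (run_letters z) ->
  \sum_(i : path_data z | counted s i) q ^+ pair_stat inv_stat (data_word i)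
  = cut_sum q (max_letter z) s (run_letters z).
Proof.
move=> anc; rewrite /cut_sum /word_sum -[RHS]big_filter.
rewrite -(perm_big _ (perm_data_words s anc)) big_map big_filter big_enum_cond /=.
by apply: eq_bigl => i.
Qed.

(** Area, monomial, bonus and number of decorations depend only on [s] and the multiset of letters,
    so they leave the sum and only inversions remain. *)
Lemma LSQ_cut_sum z s : anchored (run_letters z) ->
  LSQ z s =
    (qv ^ ((negative_letters s (run_letters z))%:Z - (count mk (run_letters z))%:Z)
     * tv ^ total_level (run_letters z) * cut_sum qv (max_letter z) s (run_letters z))
    *: \prod_(x <- run_letters z) xv (lb x).
Proof.
move=> anc; set T := run_letters z; set M := max_letter z.
set c := qv ^ _ * _; set X := \prod_(x <- T) _.
transitivity (\sum_(i : path_data z | counted s i)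
    (c * qv ^+ pair_stat inv_stat (data_word i)) *: X).
  rewrite /LSQ pair_bigA pair_big_dep /=.
  apply: eq_bigr => -[[p w] dv] /and3P[/= hv /eqP sp /eqP hz].
  have sq_p : square_path (size z) p by case/and3P: hv.
  have hp : perm_eq (@data_word z ((p, w), dv)) T by apply: perm_path_word.
  have eX : xpath (map val w) = X.
    by rewrite (xpath_path_word p dv (size_labels w)); exact: perm_big.
  have eA : area (size z) p = total_level T.
    by rewrite (area_path_word (map val w) dv sq_p); exact: perm_big.
  have eD : dinv p (map val w) dv = (pair_stat inv_stat (@data_word z ((p, w), dv)))%:Z
      + ((negative_letters s T)%:Z - (count mk T)%:Z).
    by rewrite (dinv_path_word (map val w) dv sq_p) sp /negative_letters -!(permP hp) addrA.
  by rewrite eX eA eD exprz_shift // qv_neq0.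
by rewrite sum_scaled (sum_data_words qv s anc).
Qed.

Lemma LSQ_eq0 z s : ~~ anchored (run_letters z) -> LSQ z s = 0.
Proof.
move=> nanc; rewrite /LSQ big1 // => p _; rewrite big1 // => w _; rewrite big_pred0 // => dv.
apply/negP => /and3P[hv _ /eqP hz]; have sq_p : square_path (size z) p by case/and3P: hv.
move/negP: nanc; apply; rewrite -(perm_anchored (perm_path_word sq_p hv hz)).
exact: path_word_anchored hv.
Qed.

Lemma count_layer (P : pred mletter) i (S : seq letter) :
  count P (layer i S) = count (fun x => (lv x == i.+1) && P (lb x, mk x)) S.
Proof. by rewrite count_map count_filter; apply: eq_count => x; rewrite /= andbC. Qed.

Lemma sched_slots z k : sched z k = slots k (run_letters z).
Proof.
rewrite /sched /slots /rho' size_filter -layer_run_letters count_layer; congr (_%:Z - _%:Z).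
  by apply: eq_count => x; rewrite lt0n [~~ _ && _]andbC.
(* For [k = 0] the convention for index -1 agrees with the absence of letters on level 0. *)
case: k => [|k].
  apply/esym/eqP; rewrite -leqn0 leqNgt -has_count.
  apply/hasPn => x /run_letters_lv/andP[x0 _].
  by rewrite gtn_eqF.
rewrite -[X in zbullet _ X _]/(k.+1%:Z - 1) -addn1 PoszD addrK /=.
rewrite -layer_run_letters count_layer addn1.
by apply: eq_count => x; rewrite /= xpair_eqE; case: (mk x).
Qed.

Lemma negative_lettersS k S :
  negative_letters k.+1 S = (negative_letters k S + (nz_unmarked k.+1 S + nz_marked k.+1 S))%N.
Proof.
rewrite /negative_letters /nz_unmarked /nz_marked.
elim: S => //= x S ->; case: (mk x); case: (lb x) => [|c] /=; lia.
Qed.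

(** The bonus grows by [u + d = A + (d + m)]: the part [d + m] is absorbed by the cut relation and
    [A] is the power of q in the theorem. *)
Lemma cleared_quotient (K : fieldType) (q t iA iB Gh Gl : K) (A B : int) (n u d m j : nat) :
  q != 0 -> 1 - q != 0 -> (1 - q) * iA = qbrz q A -> (1 - q) * iB = qbrz q B ->
  A = u%:Z - m%:Z ->
  qbrz q A * q ^+ (d + m) * Gh = qbrz q B * Gl ->
  iA * (q ^ ((n + (u + d))%N%:Z - j%:Z) * t * Gh)
  = q ^ A * iB * (q ^ (n%:Z - j%:Z) * t * Gl).
Proof.
move=> q0 q1 hA hB eA rel; apply: (mulfI q1).
rewrite (mulrA _ iA) hA.
have -> : q ^ ((n + (u + d))%N%:Z - j%:Z) = q ^ (n%:Z - j%:Z) * q ^ A * q ^+ (d + m).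
  by rewrite (exprnP q) -!expfzDr // eA; congr (_ ^ _); lia.
transitivity (q ^ A * q ^ (n%:Z - j%:Z) * t * (qbrz q B * Gl)); last by rewrite -hB; ring.
by rewrite -rel; ring.
Qed.

Lemma scaled_quotient (K : fieldType) (V : lmodType K) (q t iA iB Gh Gl : K) (X : V)
    (A B : int) (n u d m j : nat) :
  q != 0 -> 1 - q != 0 -> (1 - q) * iA = qbrz q A -> (1 - q) * iB = qbrz q B ->
  A = u%:Z - m%:Z ->
  qbrz q A * q ^+ (d + m) * Gh = qbrz q B * Gl ->
  iA *: ((q ^ ((n + (u + d))%N%:Z - j%:Z) * t * Gh) *: X)
  = (q ^ A * iB) *: ((q ^ (n%:Z - j%:Z) * t * Gl) *: X).
Proof.
by move=> q0 q1 hA hB eA rel; rewrite !scalerA (cleared_quotient t n j q0 q1 hA hB eA rel).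
Qed.

Lemma divide_scaled (K : fieldType) (V : lmodType K) (a b c : K) (x y : V) :
  a != 0 -> a *: x = (c * b) *: y -> x = (c * (b / a)) *: y.
Proof.
by move=> a0 e; rewrite -[LHS](scalerK a0) e scalerA mulrA mulrC.
Qed.

Lemma qv_neq1 : 1 - qv != 0.
Proof. by rewrite subr_eq0 eq_sym -[qv]expr1 qv_nonroot. Qed.

(* The quotient formula wherever its denominator is nonzero, and for all z and s
   the formula with the denominator cleared. *)
Theorem theorem6p1 (z : seq mletter) (s : nat) (hs : (1 <= s)%N) :
  (qint (sched z s.-1) != 0 ->
     LSQ z s =
       (qv ^ sched z s.-1 * (qint (sched z s) / qint (sched z s.-1)))
         *: LSQ z s.-1)
  /\ qint (sched z s.-1) *: LSQ z s =
       (qv ^ sched z s.-1 * qint (sched z s)) *: LSQ z s.-1.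
Proof.
case: s hs => [//|k _]; rewrite succnK.
have cleared : qint (sched z k) *: LSQ z k.+1
    = (qv ^ sched z k * qint (sched z k.+1)) *: LSQ z k.
  have [anc|nanc] := boolP (anchored (run_letters z)); last first.
    by rewrite (LSQ_eq0 k.+1 nanc) (LSQ_eq0 k nanc) !scaler0.
  rewrite (LSQ_cut_sum k.+1 anc) (LSQ_cut_sum k anc) negative_lettersS.
  have rel := @cut_relation_all _ qv (max_letter z) k qv_nonroot
    (run_letters z) (@lb_run_letters z).
  rewrite /cut_relation -(sched_slots z k) -(sched_slots z k.+1) in rel.
  exact: (scaled_quotient _ _ _ _ qv_neq0 qv_neq1 (qint_qbrz _) (qint_qbrz _)
    (sched_slots z k) rel).
split; last exact: cleared.
move=> nz; exact: divide_scaled nz cleared.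
Qed.
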